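(* Let $N,m,n\ge1$ be integers and let $1\le t\le\min\{m,n\}$. Almost all determinantal varieties of type $(m,n,t)$ are EIDS; that is, there is a proalgebraic set $A\subset M_{mn}(\mathcal{O}_N)$ of infinite codimension such that for every $F\in M_{mn}(\mathcal{O}_N)\setminus A$ for which $X=F^{-1}(M_{mn}^t)$ is a germ at $0\in\mathbb{C}^N$ of a determinantal variety of type $(m,n,t)$, the germ $(X,0)$ (defined by $F$) has an essentially isolated determinantal singularity at the origin.
   Context: $M_{mn}\cong\mathbb{C}^{mn}$ is the space of complex $m\times n$ matrices, and $M_{mn}^t\subset M_{mn}$ is the subset of matrices of rank less than $t$; it is an irreducible algebraic variety of codimension $(m-t+1)(n-t+1)$, and it is stratified as $M_{mn}^t=\bigsqcup_{i=1,\ldots,t}(M_{mn}^i\setminus M_{mn}^{i-1})$ (with $M_{mn}^0=\emptyset$). $\mathcal{O}_N$ is the ring of germs at $0$ of analytic functions on $\mathbb{C}^N$, and $M_{mn}(\mathcal{O}_N)\cong\mathcal{O}_N^{mn}$ is the set of holomorphic map germs $F:(\mathbb{C}^N,0)\to M_{mn}$ (the value $F(0)$ is not required to be $0$). A determinantal variety of type $(m,n,t)$ in an open domain $U\subset\mathbb{C}^N$ is a preimage $X=F^{-1}(M_{mn}^t)$, with $F:U\to M_{mn}$ having complex analytic entries, such that the codimension of $X$ in $\mathbb{C}^N$ is $(m-t+1)(n-t+1)$. A germ $(X,0)\subset(\mathbb{C}^N,0)$ of a determinantal variety of type $(m,n,t)$, defined by $F$, has an essentially isolated determinantal singularity (EIDS)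 at the origin if $F$ is transverse to all strata $M_{mn}^i\setminus M_{mn}^{i-1}$, $1\le i\le t$, of $M_{mn}^t$ in a punctured neighbourhood of the origin. Let $J^r$ denote the finite-dimensional complex vector space of $r$-jets at $0$ of germs in $M_{mn}(\mathcal{O}_N)$, and $\pi:J^{r+1}\to J^r$ the canonical projection. If $A_r\subset J^r$ are algebraic sets with $A_{r+1}\subset\pi^{-1}(A_r)$ for all $r$, then the set $A$ of germs $F\in M_{mn}(\mathcal{O}_N)$ with $j^rF(0)\in A_r$ for all $r$ is called proalgebraic. The codimension of $A_r$ in $J^r$ is non-decreasing in $r$, and one writes $\operatorname{codim}A=\lim_{r\to\infty}\operatorname{codim}A_r$. *)

(* Defs.v *)
From HB Require Import structures.
From mathcomp Require Import all_boot all_order all_algebra.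
From mathcomp Require Import complex.
From mathcomp Require Import all_classical all_reals all_analysis.
(* The notations of mpoly clash with those of MathComp-Analysis. *)
From mathcomp Require Import -(notations) mpoly.

Set Implicit Arguments.
Unset Strict Implicit.
Unset Printing Implicit Defensive.

Import Order.TTheory GRing.Theory Num.Theory numFieldNormedType.Exports.

Local Open Scope classical_set_scope.
Local Open Scope ring_scope.

(* Everything is set up over a numFieldType C, to be instantiated with R[i] for
   R : realType; C carries the topology of its norm, and 0 < x in C says that x
   is real and positive. *)

Section AnalyticFunctions.
Variables (C : numFieldType) (N : nat).
Implicit Types (c : multinom N -> C) (x p : 'rV[C]_N).

Definition monomial_at (a : multinom N) x : C := \prod_(i < N) x 0 i ^+ a i.

Definition power_sum c (d : nat) x : C :=
  \sum_(a : bmultinom N d) c a * monomial_at a x.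

(* The power series c converges absolutely on some polydisc of radius rho
   around p, and its sum there is f. *)
Definition has_power_series (f : 'rV[C]_N -> C) p c : Prop :=
  exists rho : C, [/\ 0 < rho,
    exists M : C, forall d,
      power_sum (fun a => `|c a|) d (const_mx rho) <= M
  & forall x, (forall i, `|x 0 i| < rho) ->
      power_sum c d x @[d --> \oo] --> f (p + x)].

Definition analytic_at m n (F : 'rV[C]_N -> 'M[C]_(m, n)) p : Prop :=
  forall i j, exists c, has_power_series (fun x => F x i j) p c.

Definition analytic_germ m n (F : 'rV[C]_N -> 'M[C]_(m, n)) : Prop :=
  \forall x \near (0 : 'rV[C]_N), analytic_at F x.

(* The power series of an analytic function at p is unique; the value is
   irrelevant when f is not analytic at p. *)
Definition taylor (f : 'rV[C]_N -> C) p : multinom N -> C :=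
  get [set c | has_power_series f p c].

End AnalyticFunctions.

Section AlgebraicSets.
Variables (C : numFieldType) (I : finType).
Implicit Types Z Y : set {ffun I -> C}.

(* The affine space C^I, its points being read as points of C^#|I| through
   the enumeration of I. *)
Definition algebraic Z : Prop :=
  exists S : set (mpoly #|I| C),
    Z = [set z | forall q, S q -> meval (fun k => z (enum_val k)) q = 0].

Definition irreducible_closed Y : Prop :=
  [/\ algebraic Y, Y !=set0
    & forall Y1 Y2, algebraic Y1 -> algebraic Y2 ->
        Y = Y1 `|` Y2 -> Y = Y1 \/ Y = Y2].

(* codim Z >= k, where the codimension of an irreducible closed set Y is the
   supremum of the lengths of chains Y = Y_0 < Y_1 < ... of irreducible closed
   sets, and that of Z is the infimum of codim Y over all irreducible closed Y
   inside Z.  In particular the empty set has infinite codimension. *)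
Definition codim_ge Z (k : nat) : Prop :=
  forall Y, irreducible_closed Y -> Y `<=` Z ->
  exists Y_ : nat -> set {ffun I -> C},
    [/\ Y_ 0%N = Y,
        forall i, (i <= k)%N -> irreducible_closed (Y_ i)
      & forall i, (i < k)%N -> Y_ i `<` Y_ i.+1].

End AlgebraicSets.

Section Jets.
Variables (C : numFieldType) (N m n : nat).

(* J^r, a jet being the family of its Taylor coefficients of degree <= r. *)
Definition jet (r : nat) : Type :=
  {ffun bmultinom N r.+1 * 'I_m * 'I_n -> C}.

Definition jet_of (r : nat) (F : 'rV[C]_N -> 'M[C]_(m, n)) : jet r :=
  [ffun k => taylor (fun x => F x k.1.2 k.2) 0 (bmnm k.1.1)].

Definition jet_proj (r : nat) (z : jet r.+1) : jet r :=
  [ffun k => z (BMultinom (leqW (bmdeg k.1.1)), k.1.2, k.2)].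

(* Germs are represented by functions on C^N that are analytic near 0; a
   proalgebraic set depends on germs only. *)
Definition proalgebraic_infinite_codim
    (A : set ('rV[C]_N -> 'M[C]_(m, n))) : Prop :=
  exists A_ : forall r, set (jet r),
    [/\ forall r, algebraic (A_ r),
        forall r, A_ r.+1 `<=` @jet_proj r @^-1` A_ r,
        A = [set F | analytic_germ F /\ forall r, A_ r (jet_of r F)]
      & forall k, \forall r \near \oo, codim_ge (A_ r) k].

End Jets.

Section DeterminantalSingularities.
Variables (C : numFieldType) (N m n : nat).
Implicit Types (F : 'rV[C]_N -> 'M[C]_(m, n)) (X U : set 'rV[C]_N).
Implicit Types (S : set 'M[C]_(m, n)).

Definition rank_lt (t : nat) : set 'M[C]_(m, n) := [set B | (\rank B < t)%N].

Definition stratum (i : nat) : set 'M[C]_(m, n) := rank_lt i `\` rank_lt i.-1.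

(* Near z, the set X is a complex submanifold of codimension k. *)
Definition regular_point X (k : nat) (z : 'rV[C]_N) : Prop :=
  X z /\ exists G : 'rV[C]_N -> 'rV[C]_k,
    [/\ \forall x \near z, analytic_at G x,
        \forall x \near z, X x <-> G x = 0
      & forall w, exists u, 'd G z u = w].

(* The dimension of an analytic set is the largest dimension of its regular
   points.  The empty set is given every codimension. *)
Definition analytic_codim X (k : nat) : Prop :=
  (forall j z, regular_point X j z -> (k <= j)%N) /\
  (X !=set0 -> exists z, regular_point X k z).

Definition determinantal_variety F (t : nat) U : Prop :=
  [/\ open U, forall x, U x -> analytic_at F x
    & analytic_codim (U `&` F @^-1` rank_lt t) ((m - t + 1) * (n - t + 1))].

Definition determinantal_germ F (t : nat) : Prop :=
  exists2 U, U 0 & determinantal_variety F t U.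

(* The tangent space at B of a complex submanifold S, as the set of velocities
   of holomorphic curves in S through B. *)
Definition tangent_space S (B : 'M[C]_(m, n)) : set 'M[C]_(m, n) :=
  [set v | exists g : C -> 'M[C]_(m, n),
    [/\ g 0 = B, \forall s \near (0 : C), derivable g s 1 /\ S (g s)
      & 'D_1 g 0 = v]].

Definition transverse_at F S (x : 'rV[C]_N) : Prop :=
  S (F x) -> forall w : 'M[C]_(m, n),
    exists u v, tangent_space S (F x) v /\ w = 'd F x u + v.

Definition is_EIDS F (t : nat) : Prop :=
  determinantal_germ F t /\
  \forall x \near (0 : 'rV[C]_N)^',
    forall i, (1 <= i <= t)%N -> transverse_at F (stratum i) x.

End DeterminantalSingularities.

(* Main.v *)
Require Import Defs.
From mathcomp Require Import all_boot all_order all_algebra.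
From mathcomp Require Import complex.
From mathcomp Require Import all_classical all_reals all_analysis.
From mathcomp Require Import -(notations) mpoly.
From mathcomp Require Import ring zify.

(** Put C = R[i].  At a point x, the vectors P F(x) + F(x) Q are tangent to the
    orbit of F(x) under row and column operations, that is, to its rank stratum.
    So F is transverse at x to all strata as soon as the matrices d_j F(x),
    E_ik F(x) and F(x) E_kl span the space of all m x n matrices, that is, as
    soon as one of the mn x mn minors formed from these matrices (tminor) does
    not vanish at x.  Call F good if this holds at all x <> 0 near 0.  Every
    good germ that defines a determinantal variety is an EIDS, whatever t is
    (orbit_tangent, minors_transverse), so it suffices to enclose the other
    germs, the bad ones, in a proalgebraic set of infinite codimension.  The
    set A_r used here is the smallest possible one, the Zariski closure of the
    r-jets of the bad germs.

    The codimension of A_r grows to infinity provided that every r-jet extends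
    to a jet of some order l = l(r) outside A_l.  Indeed an irreducible Y in A_l
    projects to a set with closure W in A_r; the cylinder over W is irreducible
    and, by the extension property, strictly larger than Y, so that a chain of
    length k above W gives one of length k + 1 above Y (codim_step,
    bad_germs_infinite_codim).

    To leave A_l, one adds to the r-jet f a homogeneous matrix G of degree
    r + 1 whose minors vanish together at 0 only.  By the Nullstellensatz the
    ideal of the minors of G contains all monomials of some degree s, and then
    a comparison of leading forms shows that modulo the minors of f + G every
    polynomial is equivalent to one of degree < s, whatever f is
    (minor_ideal_reduce): the top degree part is what counts at infinity.  So
    the quotient by the minors of f + G has dimension at most d, the number of
    monomials of degree < s.  For l > d, having quotient of dimension < l
    modulo degree l is expressed by the nonvanishing of a minor of a matrix
    whose entries are polynomials in the l-jet, so it is an open condition on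
    jets (exists_certificate).  By the pigeonhole principle it gives a j < l
    such that the monomials of degree j are combinations of the minors up to
    terms of degree > j (graded_step), and for an analytic germ F with such an
    l-jet this prevents the minors from vanishing together at small x <> 0
    (finite_colength_good): otherwise |x|^j = O(|x|^(j+1)).

    For G one takes the sum of the x_l^(r+1) A_l, where the entries of the
    matrices A_l are algebraically independent over Q.  At a common zero x <> 0
    of the minors there are a matrix w <> 0 orthogonal to the A_l with x_l <> 0
    and a combination B of these A_l such that w B^T = 0 and w^T B = 0.  Such
    pairs (B, w), up to scaling w, form a family with mn - 1 parameters
    (conormal_pair_gen), and a count shows that the A_l would then be
    polynomials in N m n - 1 numbers, which is fewer than the number of their
    independent entries (exists_transverse_family). *)

Set Implicit Arguments.
Unset Strict Implicit.
Unset Printing Implicit Defensive.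

Import Order.TTheory GRing.Theory Num.Theory numFieldNormedType.Exports.

Local Open Scope classical_set_scope.
Local Open Scope ring_scope.

Local Notation xvar i := (mpolyX _ (mnm1 i)).
Local Notation msz := (mmeasure mdeg).
Local Notation homog d := (ishomog1 d mdeg).

(** * Uncountable fields *)

(** Stated as the impossibility of exhausting T by a sequence of finite lists:
    the points to avoid below are always countably many finite sets of roots.
*)
Definition uncountable (T : eqType) : Prop :=
  forall L : nat -> seq T, exists c, forall k, c \notin L k.

(** Already the real axis cannot be exhausted: a countable subset of it has
    Lebesgue measure 0. *)
Lemma uncountable_complex (R : realType) : uncountable R[i]%C.
Proof.
move=> L.
pose A : set R := \bigcup_k [set x | complex.Complex x 0 \in L k].
have cA : countable A.
  apply: bigcup_countable => // k _.
  apply: (@sub_countable _ _ _ [set` map (@complex.Re R) (L k)]).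
    apply: subset_card_le => x /= Lx; apply/mapP; by exists (complex.Complex x 0).
  exact: finite_set_countable.
have /existsNP[x Ax] : ~ forall x, A x.
  move=> AT; have := countable_lebesgue_measure0 cA.
  have -> : A = [set` `]-oo, +oo[] by rewrite set_itvNyy; apply/seteqP; split.
  by rewrite lebesgue_measure_itv.
exists (complex.Complex x 0) => k; apply/negP => kx; apply: Ax; by exists k.
Qed.

(** If every P k held at finitely many points only, the lists of these points
    would exhaust T. *)
Lemma uncountable_infinite (T : eqType) (P : nat -> T -> Prop) (c0 : T) :
  uncountable T -> (forall x, x != c0 -> exists k, P k x) ->
  exists k, forall n, exists s : seq T,
    [/\ size s = n, uniq s & forall x, x \in s -> x != c0 /\ P k x].
Proof.
move=> unc cov; apply: contrapT => /forallNP noinf.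
have fin k : exists s : seq T, forall x, x != c0 -> P k x -> x \in s.
  have /existsNP[n nex] := noinf k.
  apply: contrapT => /forallNP nfin; apply: nex.
  elim: n => [|n [s [ss us Ps]]]; first by exists [::].
  have /existsNP[x /not_implyP[x0 /not_implyP[Px xs]]] := nfin s.
  exists (x :: s); split=> /=; first by rewrite ss.
    by rewrite us andbT; apply/negP.
  by move=> y; rewrite inE => /orP[/eqP->//|/Ps].
pose L k := projT1 (cid (fin k)).
have [c Lc] := unc (fun k => c0 :: L k).
have c0' : c != c0 by have := Lc 0%N; rewrite inE negb_or => /andP[].
have [k Pk] := cov c c0'.
have := Lc k; rewrite inE negb_or => /andP[_ /negP]; apply.
exact: (projT2 (cid (fin k))).
Qed.

(** * The Nullstellensatz over an uncountable field *)

Lemma row_dependence (F : fieldType) m n (M : 'M[F]_(m, n)) :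
  (n < m)%N -> exists2 u : 'rV_m, u != 0 & u *m M = 0.
Proof.
move=> ltnm; have : kermx M != 0.
  rewrite -mxrank_eq0 mxrank_ker subn_eq0 -ltnNge.
  exact: leq_ltn_trans (rank_leq_col M) ltnm.
by case/rowV0Pn => u /sub_kermxP uM u0; exists u.
Qed.

Definition is_ideal (A : comNzRingType) (J : A -> Prop) : Prop :=
  [/\ J 0, forall p q, J p -> J q -> J (p + q) & forall p q, J q -> J (p * q)].

Section Ideals.
Variables (A : comNzRingType) (J : A -> Prop).
Hypothesis idJ : is_ideal J.

Lemma ideal0 : J 0. Proof. by case: idJ. Qed.
Lemma idealD p q : J p -> J q -> J (p + q). Proof. by case: idJ => _ + _; apply. Qed.
Lemma idealM p q : J q -> J (p * q). Proof. by case: idJ => _ _; apply. Qed.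
Lemma idealMr p q : J q -> J (q * p). Proof. by rewrite mulrC; apply: idealM. Qed.
Lemma idealN p : J p -> J (- p).
Proof. by move=> Jp; rewrite -mulN1r; apply: idealM. Qed.
Lemma idealB p q : J p -> J q -> J (p - q).
Proof. by move=> Jp /idealN; apply: idealD. Qed.
Lemma ideal_sum (I : Type) (r : seq I) (P : pred I) (f : I -> A) :
  (forall i, P i -> J (f i)) -> J (\sum_(i <- r | P i) f i).
Proof. by move=> Jf; elim/big_ind: _ => //; [apply: ideal0|apply: idealD]. Qed.

Lemma ideal_adjoin f : is_ideal (fun p => exists q, J (p - q * f)).
Proof.
split; first by exists 0; rewrite mul0r subr0; apply: ideal0.
  move=> p q [u Ju] [v Jv]; exists (u + v).
  by have := idealD Ju Jv; congr J; ring.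
by move=> p q [u Ju]; exists (p * u); have := idealM p Ju; congr J; ring.
Qed.

End Ideals.

Lemma mpoly_dependence (F : fieldType) (n d k : nat) (q : 'I_k -> mpoly n F) :
    (forall i, (mmeasure mdeg (q i) <= d)%N) -> (#|{: bmultinom n d}| < k)%N ->
  exists2 u : 'rV[F]_k, u != 0 & \sum_i u 0 i *: q i = 0.
Proof.
move=> qd /(row_dependence (\matrix_(i < k, b < #|{: bmultinom n d}|)
   mcoeff (bmnm (enum_val b)) (q i))) [u u0 uM]; exists u => //.
apply/mpolyP => m; rewrite raddf_sum mcoeff0 /=.
case: (ltnP (mdeg m) d) => md; last first.
  rewrite big1 // => i _; rewrite mcoeffZ memN_msupp_eq0 ?mulr0 //.
  by apply: msize_mdeg_ge; apply: leq_trans md.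
have /matrixP/(_ 0 (enum_rank (BMultinom md))) := uM.
rewrite mxE [RHS]mxE => uM0; rewrite -[RHS]uM0; apply: eq_bigr => i _.
by rewrite mxE enum_rankK mcoeffZ.
Qed.

Section Elimination.
Variables (K : closedFieldType) (n : nat).
Local Notation P := (mpoly n K).
Implicit Types (J : P -> Prop).

(** Let q_c be an inverse of x_i - c modulo J.  Since K is uncountable, the
    degree of q_c is bounded along an infinite set of values c, so that finitely
    many of these inverses are linearly dependent.  Clearing denominators in the
    relation gives a nonzero polynomial h in x_i alone that lies in J.  All its
    linear factors but x_i are invertible modulo J, so a power of x_i is left.
*)
Lemma ideal_elimination J i (unc : uncountable K) : is_ideal J ->
    (forall c : K, c != 0 -> exists q, J (1 - q * (xvar i - mpolyC n c))) ->
  exists e, J (xvar i ^+ e).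
Proof.
move=> idJ inv.
have [//|d dP] := @uncountable_infinite _
  (fun d c => exists2 q, (mmeasure mdeg q <= d)%N & J (1 - q * (xvar i - mpolyC n c)))
  0 unc.
  by move=> c /inv[q Jq]; exists (mmeasure mdeg q), q.
set k := #|{: bmultinom n d}|.+1.
have [s [ss us sP]] := dP k.
pose c (j : 'I_k) := s`_j.
have /choice[q qP] : forall j : 'I_k, exists q,
    (mmeasure mdeg q <= d)%N /\ J (1 - q * (xvar i - mpolyC n (c j))).
  move=> j; have [|_ [q qd Jq]] := sP (c j); last by exists q.
  by apply: mem_nth; rewrite ss.
have [u u0 uq] := mpoly_dependence (fun j => (qP j).1) (leqnn k).
(* The relation between the inverses q j, multiplied by all the x_i - c_l,
   modulo J. *)
pose h : {poly K} := \sum_j u 0 j *: \prod_(l | l != j) ('X - (c l)%:P).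
have h0 : h != 0.
  have /existsP[j uj] : [exists j, u 0 j != 0].
    apply: contraNT u0 => /existsPn uz; apply/eqP/rowP => j; rewrite mxE.
    by apply/eqP; have := uz j; rewrite negbK.
  apply/eqP => /(congr1 (fun p => p.[c j])); rewrite horner0 /h horner_sum.
  rewrite (bigD1 j) //= [X in _ + X]big1 ?addr0.
    rewrite hornerZ horner_prod => /eqP; rewrite mulf_eq0 (negPf uj) /=.
    move/prodf_eq0 => [l lj]; rewrite hornerXsubC subr_eq0 nth_uniq ?ss //.
    by rewrite eq_sym => /eqP/val_inj/eqP; rewrite (negPf lj).
  move=> l lj; rewrite hornerZ horner_prod (bigD1 j) 1?eq_sym //=.
  by rewrite hornerXsubC subrr mul0r mulr0.
pose ev (p : {poly K}) : P := horner (map_poly (@mpolyC n K) p) (xvar i).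
have evh : J (ev h).
  pose Q j := \prod_(l | l != j) (xvar i - mpolyC n (c l)).
  have evE : ev h = \sum_j u 0 j *: Q j.
    rewrite /ev /h raddf_sum horner_sum; apply: eq_bigr => j _.
    rewrite /= map_polyZ hornerZ -mul_mpolyC; congr (_ * _).
    rewrite rmorph_prod horner_prod; apply: eq_bigr => l _.
    by rewrite rmorphB /= map_polyX map_polyC hornerXsubC.
  (* This sum differs from ev h by a multiple of the relation uq, which is 0. *)
  have -> : ev h = \sum_j u 0 j *: (Q j * (1 - q j * (xvar i - mpolyC n (c j)))).
    pose T := \prod_l (xvar i - mpolyC n (c l)).
    have T0 : \sum_j u 0 j *: (T * q j) = 0.
      rewrite -[RHS](mulr0 T) -[X in T * X]uq mulr_sumr.
      by apply: eq_bigr => j _; rewrite -scalerAr.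
    rewrite evE; apply/eqP; rewrite -subr_eq0 -[X in _ == X]T0 -sumrB; apply/eqP.
    apply: eq_bigr => j _; rewrite /T (bigD1 j) //= -/(Q j) -!mul_mpolyC; ring.
  apply: (ideal_sum idJ) => j _; rewrite -mul_mpolyC; do 2!apply: (idealM idJ).
  exact: (qP j).2.
have [r hr] := closed_field_poly_normal h.
have evr : J (\prod_(z <- r) (xvar i - mpolyC n z)).
  have := idealM idJ (mpolyC n (lead_coef h)^-1) evh; congr J.
  rewrite /ev {2}hr map_polyZ hornerZ mulrA -mpolyCM mulVf ?lead_coef_eq0 //.
  rewrite mul1r rmorph_prod horner_prod; apply: eq_bigr => l _.
  by rewrite rmorphB /= map_polyX map_polyC hornerXsubC.
suff gen : forall p, J (p * \prod_(z <- r) (xvar i - mpolyC n z)) ->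
    exists e, J (p * xvar i ^+ e).
  have [|e] := gen 1; first by rewrite mul1r.
  by rewrite mul1r => Je; exists e.
elim: {hr evr} r => [|z r IH] p.
  by rewrite big_nil => Jp; exists 0%N; rewrite expr0.
rewrite big_cons mulrA => /IH[e].
have [->|z0] := eqVneq z 0.
  by rewrite mpolyC0 subr0 => Je; exists e.+1; rewrite exprS mulrA.
have [w Jw] := inv z z0; move=> Je; exists e.
have := idealD idJ (idealM idJ w Je) (idealM idJ (p * xvar i ^+ e) Jw).
by congr J; ring.
Qed.

(** Weak Nullstellensatz.  A proper ideal J stays proper after adjoining x_i - c
    for a suitable c: otherwise all the x_i - c would be invertible modulo J,
    while elimination makes x_i nilpotent.  Adjoining such elements for all
    variables in turn produces the coordinates of a zero. *)
Lemma ideal_point J (unc : uncountable K) : is_ideal J -> ~ J 1 ->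
  exists v : 'I_n -> K, forall p, J p -> meval v p = 0.
Proof.
move=> idJ J1.
suff : forall s : seq 'I_n, exists J' : P -> Prop, [/\ is_ideal J', ~ J' 1,
    forall p, J p -> J' p & forall i, i \in s -> exists c, J' (xvar i - mpolyC n c)].
  move=> /(_ (enum 'I_n))[J' [idJ' J'1 sJ Jc]].
  have /choice[v vP] : forall i, exists c, J' (xvar i - mpolyC n c).
    by move=> i; apply: Jc; rewrite mem_enum.
  have ev p : J' (p - mpolyC n (meval v p)).
    elim/mpolyind: p => [|c m p mp c0 IH].
      by rewrite meval0 mpolyC0 subr0; apply: ideal0.
    have mX : J' (mpolyX K m - mpolyC n (meval v (mpolyX K m))).
      rewrite mpolyXE_id rmorph_prod /= rmorph_prod /=.
      elim/big_ind2: _ => [|x1 x2 y1 y2 h1 h2|j _]; first by rewrite subrr; apply: ideal0.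
        have := idealD idJ' (idealMr idJ' y1 h1) (idealM idJ' x2 h2).
        by congr J'; ring.
      rewrite rmorphXn /= mevalXU rmorphXn /= subrXX; apply: idealMr => //.
    have := idealD idJ' (idealM idJ' (mpolyC n c) mX) IH.
    by congr J'; rewrite mevalD mevalZ mpolyCD mpolyCM -!mul_mpolyC; ring.
  exists v => p /sJ J'p; apply: contrapT => /eqP v0; apply: J'1.
  have := idealM idJ' (mpolyC n (meval v p)^-1) (idealB idJ' J'p (ev p)).
  by rewrite opprB addrC subrK -mpolyCM mulVf // mpolyC1.
elim=> [|i s [J' [idJ' J'1 sJ Jc]]]; first by exists J; split.
have [c cP] : exists c, ~ exists q, J' (1 - q * (xvar i - mpolyC n c)).
  apply: contrapT => /forallNP noc.
  have inv c : exists q, J' (1 - q * (xvar i - mpolyC n c)).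
    by apply: contrapT; apply: noc.
  have [e Je] := ideal_elimination unc idJ' (fun c _ => inv c).
  have [q] := inv 0; rewrite mpolyC0 subr0 => Jq.
  apply: J'1; elim: e Je => [|e IH Je]; first by rewrite expr0.
  apply: IH; have := idealD idJ' (idealM idJ' q Je) (idealM idJ' (xvar i ^+ e) Jq).
  by congr J'; rewrite exprS; ring.
exists (fun p => exists q, J' (p - q * (xvar i - mpolyC n c))); split.
- exact: ideal_adjoin.
- exact: cP.
- by move=> p /sJ Jp; exists 0; rewrite mul0r subr0.
move=> j; rewrite inE => /orP[/eqP->|/Jc[b Jb]].
  by exists c, 1; rewrite mul1r subrr; apply: ideal0.
by exists b, 0; rewrite mul0r subr0.
Qed.

(** For c <> 0, the ideal generated by J and x_i - c has no zero, hence it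
    contains 1; so every variable is nilpotent modulo J by elimination. *)
Lemma ideal_monomials J (unc : uncountable K) : is_ideal J ->
    (forall v : 'I_n -> K, (forall p, J p -> meval v p = 0) -> forall i, v i = 0) ->
  exists s, forall m, (s <= mdeg m)%N -> J (mpolyX K m).
Proof.
move=> idJ V0.
have /choice[e eP] : forall i, exists e, J (xvar i ^+ e).
  move=> i; apply: ideal_elimination => // c c0; apply: contrapT => Jc.
  have [v vP] := ideal_point unc (ideal_adjoin idJ (xvar i - mpolyC n c)) Jc.
  have v0 : v i = 0.
    by apply: V0 => p Jp; apply: vP; exists 0; rewrite mul0r subr0.
  have vXc : meval v (xvar i - mpolyC n c) = 0.
    by apply: vP; exists 1; rewrite mul1r subrr; apply: ideal0.
  by move/eqP: vXc; rewrite mevalB mevalXU mevalC v0 sub0r oppr_eq0 (negPf c0).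
exists (\sum_i e i).+1 => m ms.
have [i im] : exists i, (e i <= m i)%N.
  apply: contrapT => /forallNP h; move: ms; rewrite mdegE ltnNge => /negP; apply.
  by apply: leq_sum => i _; have /negP := h i; rewrite -ltnNge => /ltnW.
rewrite mpolyXE_id (bigD1 i) //= -(subnK im) exprD.
by apply: idealMr => //; apply: idealM.
Qed.

End Elimination.

(** * Algebraically independent numbers *)

Section MorphismMmap.
Variables (n : nat) (R S T : comNzRingType).

Lemma mmap_comp (f : {rmorphism S -> T}) (g : {rmorphism R -> S})
    (h : 'I_n -> S) (p : mpoly n R) :
  f (mmap g h p) = mmap (f \o g) (f \o h) p.
Proof.
rewrite /mmap rmorph_sum; apply: eq_bigr => m _; rewrite rmorphM /=.
congr (_ * _); rewrite /mmap1 rmorph_prod; apply: eq_bigr => i _.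
by rewrite rmorphXn.
Qed.

End MorphismMmap.

Section LastVariable.
Variables (n : nat) (R : comNzRingType).
Implicit Types p : mpoly n.+1 R.

(** The exponents of all variables but the last one, which indexes the powers
    of the remaining variable in muni. *)
Definition mnm_front (m : multinom n.+1) : multinom n :=
  Multinom [tuple m (widen_ord (leqnSn n) i) | i < n].

Lemma mnm_front_inj m1 m2 :
  mnm_front m1 = mnm_front m2 -> m1 ord_max = m2 ord_max -> m1 = m2.
Proof.
move=> e12 emax; apply/mnmP => i; case: (unliftP ord_max i) => [j ->|-> //].
have /mnmP/(_ j) := e12; rewrite !mnmE.
by have -> : widen_ord (leqnSn n) j = lift ord_max j by apply/val_inj; rewrite /= /bump leqNgt ltn_ord.
Qed.

Lemma muni_eq0 p : muni p = 0 -> p = 0.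
Proof.
move=> p0; apply/mpolyP => m; rewrite mcoeff0.
have /(congr1 (fun q : {poly _} => mcoeff (mnm_front m) q`_(m ord_max))) := p0.
rewrite coef0 mcoeff0 => <-; rewrite muniE coef_sum raddf_sum /=.
have E m' : mcoeff (mnm_front m)
   (mcoeff m' p *: mpolyX R (mnm_front m') *: 'X^(m' ord_max))`_(m ord_max) =
   mcoeff m' p * (m' == m)%:R.
  rewrite coefZ coefXn; case: eqVneq => [em|nm]; last first.
    rewrite mulr0 mcoeff0; case: eqVneq => [e|_]; last by rewrite mulr0.
    by rewrite e eqxx in nm.
  rewrite mulr1 mcoeffZ mcoeffX; congr (_ * _%:R); congr nat_of_bool.
  by apply/eqP/eqP => [/mnm_front_inj->|->].
under eq_bigr do rewrite E.
case: (boolP (m \in msupp p)) => mp.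
  rewrite (bigD1_seq m) ?msupp_uniq //= eqxx mulr1 big1 ?addr0 // => m' /negPf->.
  by rewrite mulr0.
rewrite big_seq big1 => [|m' m'p]; first by apply: memN_msupp_eq0.
by case: eqVneq m'p => [->|_ _]; rewrite ?(negPf mp) ?mulr0.
Qed.

Lemma meval_muni (v : 'I_n.+1 -> R) p :
  meval v p = (map_poly (meval (fun i => v (widen_ord (leqnSn n) i))) (muni p)).[v ord_max].
Proof.
rewrite muniE rmorph_sum horner_sum mevalE; apply: eq_bigr => m _.
rewrite /= map_polyZ /= hornerZ map_polyXn hornerXn mevalZ mevalX big_ord_recr /= mulrA.
by congr (_ * _ * _); apply: eq_bigr => i _; rewrite mnmE.
Qed.

End LastVariable.

(** By induction on n, one first avoids the zeros of the leading coefficients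
    with respect to the last variable; then the values to avoid for this
    variable are the roots of countably many nonzero univariate polynomials. *)
Lemma avoid_zeros (K : closedFieldType) (unc : uncountable K) n
    (P : nat -> mpoly n K) :
  exists v : 'I_n -> K, forall k, P k != 0 -> meval v (P k) != 0.
Proof.
elim: n P => [|n IH] P.
  exists (fun _ => 0) => k; apply: contraNneq => Pk0; move: Pk0.
  by rewrite (nvar0_mpolyC (P k)) mevalC => ->; rewrite mpolyC0.
have [v vP] := IH (fun k => lead_coef (muni (P k))).
pose q k := map_poly (meval v) (muni (P k)).
have qn0 k : P k != 0 -> q k != 0.
  move=> Pk0; apply: contraNneq (vP k _) => [qk0|]; last first.
    by rewrite lead_coef_eq0; apply: contraNneq Pk0 => /muni_eq0->.
  by rewrite lead_coefE -coef_map /= -/(q k) qk0 coef0.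
have [c cP] := unc (fun k => sval (closed_field_poly_normal (q k))).
exists (fun i => if unlift ord_max i is Some j then v j else c) => k Pk0.
rewrite meval_muni unlift_none.
rewrite (_ : map_poly _ _ = q k); last first.
  apply: eq_map_poly => p /=; apply: meval_eq => i.
  have -> : widen_ord (leqnSn n) i = lift ord_max i.
    by apply/val_inj; rewrite /= /bump leqNgt ltn_ord.
  by rewrite liftK.
have := cP k; case: (closed_field_poly_normal _) => r /= rE cr.
rewrite rE hornerZ mulf_neq0 ?lead_coef_eq0 ?qn0 // horner_prod.
rewrite prodf_seq_neq0; apply/allP => z zr; rewrite /= hornerXsubC subr_eq0.
by apply: contraNneq cr => ->.
Qed.

Definition alg_indep (K : numFieldType) b (x : 'I_b -> K) : Prop :=
  forall P : mpoly b rat, P != 0 -> mmap ratr x P != 0.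

(** Polynomials over Q are coded by lists of terms, so there are countably many
    algebraic relations to avoid. *)
Lemma exists_alg_indep (K : numClosedFieldType) (unc : uncountable K) b :
  exists x : 'I_b -> K, alg_indep x.
Proof.
pose dec k : mpoly b rat := if @unpickle (seq (rat * multinom b)) k is Some s then
   \sum_(t <- s) t.1 *: mpolyX rat t.2 else 0.
have [x xP] := avoid_zeros unc (fun k => map_mpoly (@ratr K) (dec k)).
exists x => P P0.
have [k kP] : exists k, dec k = P.
  exists (pickle [seq (mcoeff m P, m) | m <- msupp P]).
  by rewrite /dec pickleK big_map [RHS]mpolyE.
have -> : mmap ratr x P = meval x (map_mpoly (@ratr K) P).
  rewrite /map_mpoly (mmap_comp (meval x) (@mpolyC b K \o ratr)).
  by congr mmap; apply/funext => y /=; rewrite ?mevalC ?mevalXU.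
rewrite -kP; apply: xP; rewrite kP; apply: contraNneq P0 => e; apply/eqP/mpolyP => m.
apply: (fmorph_inj (@ratr K)); by rewrite -mcoeff_map_mpoly e !mcoeff0 rmorph0.
Qed.

Lemma card_bmultinom n d : (#|{: bmultinom n d}| <= d ^ n)%N.
Proof.
rewrite -[X in (_ <= X ^ _)%N]card_ord -[X in (_ <= _ ^ X)%N]card_ord -card_ffun.
pose f (m : bmultinom n d) : {ffun 'I_n -> 'I_d} :=
  [ffun i => Ordinal (leq_ltn_trans (n := mdeg m)
     (leq_trans (leq_addr _ _) (eq_leq (esym (etrans (mdegE m) (bigD1 i isT)))))
     (bmdeg m))].
apply: (@leq_card _ _ f) => m1 m2 /ffunP e; apply/val_inj/mnmP => i.
by have := congr1 val (e i); rewrite !ffunE.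
Qed.

Lemma msize_prod (F : fieldType) n (I : Type) (r : seq I) (q : I -> mpoly n F) E :
  (forall i, (mmeasure mdeg (q i) <= E.+1)%N) ->
  (mmeasure mdeg (\prod_(i <- r) q i) <= (size r * E).+1)%N.
Proof.
move=> qE; elim: r => [|i r IH]; first by rewrite big_nil mul0n mmeasure1.
rewrite big_cons; have [->|q0] := eqVneq (q i) 0; first by rewrite mul0r mmeasure0.
have [->|p0] := eqVneq (\prod_(j <- r) q j) 0; first by rewrite mulr0 mmeasure0.
rewrite msizeM //; have := leq_add (qE i) IH; rewrite addSn addnS [size _]/= mulSn.
by case: (_ + _)%N.
Qed.

(** Among the monomials in b letters with exponents < k there are k^b; evaluated
    at the q_i they lie in a space of polynomials in a variables of degree
    O(k), of dimension O(k^a).  As a < b, they are dependent for k large. *)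
Lemma algebraic_dependence (F : fieldType) a b (q : 'I_b -> mpoly a F) :
  (a < b)%N -> exists2 P : mpoly b F, P != 0 & mmap (@mpolyC a F) q P = 0.
Proof.
move=> ab; pose E := (\sum_i mmeasure mdeg (q i))%N.
have qE i : (mmeasure mdeg (q i) <= E.+1)%N.
  by rewrite leqW // /E (bigD1 i) //= leq_addr.
(* With this k, the dimension (k * (b * E).+1) ^ a is less than k ^ a.+1. *)
pose k := ((b * E).+1 ^ a).+1.
pose mon (e : {ffun 'I_b -> 'I_k}) : multinom b := Multinom [tuple nat_of_ord (e j) | j < b].
have mon_inj : injective mon.
  move=> e1 e2 /mnmP e12; apply/ffunP => i; apply/val_inj.
  by have := e12 i; rewrite !mnmE.
pose Q e := mmap1 q (mon e).
have QE e : (mmeasure mdeg (Q e) <= (b * (k * E)).+1)%N.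
  rewrite /Q /mmap1; apply: leq_trans (msize_prod (E := (k * E)%N) _ _) _; last first.
    by rewrite /index_enum -enumT size_enum_ord.
  move=> i; rewrite mnmE -[X in _ ^+ X](card_ord (e i)) -prodr_const.
  rewrite -big_enum /=; apply: leq_trans (msize_prod _ (fun _ => qE i)) _.
  by rewrite -cardE card_ord ltnS leq_mul2r (ltnW (ltn_ord _)) orbT.
have [||u u0 uQ] := @mpoly_dependence F a (b * (k * E)).+1 #|{ffun 'I_b -> 'I_k}|
    (fun j => Q (enum_val j)); first by move=> i; apply: QE.
  rewrite card_ffun !card_ord; apply: leq_ltn_trans (card_bmultinom _ _) _.
  apply: (@leq_ltn_trans ((k * (b * E).+1) ^ a)); first by
    case: (posnP a) => [->|a0]; [rewrite !expn0|rewrite leq_exp2r // /k; nia].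
  apply: (@leq_trans (k ^ a.+1)); last by rewrite leq_pexp2l.
  by rewrite expnMn expnS mulnC ltn_pmul2r ?expn_gt0.
exists (\sum_j u 0 j *: mpolyX F (mon (enum_val j))).
  apply: contraNneq u0 => /mpolyP u0; apply/eqP/rowP => j; rewrite mxE.
  have := u0 (mon (enum_val j)); rewrite mcoeff0 raddf_sum /= (bigD1 j) //=.
  rewrite mcoeffZ mcoeffX eqxx mulr1 big1 ?addr0 // => l lj.
  rewrite mcoeffZ mcoeffX (inj_eq mon_inj) (inj_eq enum_val_inj) (negPf lj).
  by rewrite mulr0.
rewrite raddf_sum /= -[RHS]uQ; apply: eq_bigr => j _.
by rewrite mmapZ mmapX mul_mpolyC.
Qed.

Section GeneratedRing.
Variable K : numFieldType.
Implicit Types (s : seq K) (x y : K).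

Inductive subring_gen s : K -> Prop :=
| gen_in x : x \in s -> subring_gen s x
| gen0 : subring_gen s 0
| gen1 : subring_gen s 1
| genN x : subring_gen s x -> subring_gen s (- x)
| genD x y : subring_gen s x -> subring_gen s y -> subring_gen s (x + y)
| genM x y : subring_gen s x -> subring_gen s y -> subring_gen s (x * y).

Lemma genS s1 s2 x : {subset s1 <= s2} -> subring_gen s1 x -> subring_gen s2 x.
Proof.
move=> s12; elim=> {x} [x /s12/gen_in //|||x _|x y _ + _|x y _ + _].
- exact: gen0.
- exact: gen1.
- exact: genN.
- exact: genD.
- exact: genM.
Qed.

Lemma genB s x y : subring_gen s x -> subring_gen s y -> subring_gen s (x - y).
Proof. by move=> gx /genN; apply: genD. Qed.

Lemma gen_sum s (I : Type) (r : seq I) (P : pred I) (f : I -> K) :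
  (forall i, P i -> subring_gen s (f i)) -> subring_gen s (\sum_(i <- r | P i) f i).
Proof. by move=> gf; elim/big_ind: _ => //; [exact: gen0|exact: genD]. Qed.

Lemma gen_mpoly s x : subring_gen s x ->
  exists q : mpoly (size s) rat, x = mmap ratr (tnth (in_tuple s)) q.
Proof.
elim=> {x} [x xs|||x _ [p ->]|x y _ [p ->] _ [q ->]|x y _ [p ->] _ [q ->]].
- have /tnthP[i ->] : x \in in_tuple s by [].
  by exists (mpolyX _ (mnm1 i)); rewrite mmapX mmap1U.
- by exists 0; rewrite raddf0.
- by exists 1; rewrite rmorph1.
- by exists (- p); rewrite raddfN.
- by exists (p + q); rewrite raddfD.
by exists (p * q); rewrite rmorphM.
Qed.

(** Expressing b independent numbers through fewer generators would give an
    algebraic relation between them over Q. *)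
Lemma alg_indep_gen b (x : 'I_b -> K) s :
  alg_indep x -> (forall i, subring_gen s (x i)) -> (b <= size s)%N.
Proof.
move=> xind xs; rewrite leqNgt; apply/negP => lt_sb.
have /choice[q qP] := fun i => gen_mpoly (xs i).
have [P P0 Pq] := algebraic_dependence q lt_sb.
have /eqP := xind P P0; apply.
have : mmap ratr (tnth (in_tuple s)) (mmap (@mpolyC _ _) q P) = 0 :> K.
  by rewrite Pq raddf0.
rewrite (mmap_comp (mmap ratr (tnth (in_tuple s)))) => <-.
by congr mmap; apply/funext => y /=; rewrite ?mmapC.
Qed.

End GeneratedRing.

(** * Linear families of matrices in general position *)

Section ConormalPairs.
Variable K : numFieldType.

Lemma mem_image_fun (T : finType) (f : T -> K) (P : {pred T}) x :
  x \in P -> f x \in [seq f y | y in P].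
Proof. by move=> Px; apply/mapP; exists x; rewrite ?mem_enum. Qed.

(** The condition on (B, w) says that w is conormal at B to the stratum of
    matrices of the rank of B; the conormal variety has dimension mn, and mn - 1
    once the scale of w is fixed by an entry equal to 1.  The parameters come by
    induction.  If B = 0, they are the entries of w.  Otherwise B has an entry
    be <> 0; the Schur complement of be and the matching submatrix of w form a
    pair of the same kind, of size (m - 1) x (n - 1), and the row and the column
    of be, divided by be, determine all the rest polynomially. *)
Lemma conormal_pair_gen m n (B w : 'M[K]_(m, n)) :
    w *m B^T = 0 -> w^T *m B = 0 -> w != 0 ->
  exists s k, [/\ (size s < m * n)%N, k != 0,
    forall i j, subring_gen s (B i j),
    forall i j, subring_gen s (k * w i j) & exists i j, k * w i j = 1].
Proof.
elim: m n B w => [|m IH] [|n] B w wB Bw w0.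
- by case/negP: w0; apply/eqP/matrixP => -[].
- by case/negP: w0; apply/eqP/matrixP => -[].
- by case/negP: w0; apply/eqP/matrixP => i [].
have wBE i i' : \sum_j w i j * B i' j = 0.
  have /matrixP/(_ i i') := wB; rewrite mxE [RHS]mxE => e; rewrite -[RHS]e.
  by apply: eq_bigr => j _; rewrite mxE.
have BwE j j' : \sum_i w i j * B i j' = 0.
  have /matrixP/(_ j j') := Bw; rewrite mxE [RHS]mxE => e; rewrite -[RHS]e.
  by apply: eq_bigr => i _; rewrite mxE.
have nz_entry p q (M : 'M[K]_(p, q)) : M != 0 -> exists i j, M i j != 0.
  move=> M0; apply: contrapT => h; case/negP: M0; apply/eqP/matrixP => i j.
  rewrite mxE; apply/eqP; apply: contrapT => /negP Mij; apply: h; by exists i, j.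
have [B0|/nz_entry[i0 [j0 b0]]] := eqVneq B 0.
  have [a [b wab]] := nz_entry _ _ _ w0.
  pose f (p : 'I_m.+1 * 'I_n.+1) := (w a b)^-1 * w p.1 p.2.
  exists [seq f p | p in predC1 (a, b)], (w a b)^-1; split.
  - by rewrite size_image cardC1 card_prod !card_ord.
  - by rewrite invr_eq0.
  - by move=> i j; rewrite B0 mxE; exact: gen0.
  - move=> i j; have [[-> ->]|ne] := eqVneq (i, j) (a, b).
      by rewrite mulVf //; exact: gen1.
    by apply: gen_in; apply: (@mem_image_fun _ f _ (i, j)).
  by exists a, b; rewrite mulVf.
set be := B i0 j0 in b0.
pose u k := B (lift i0 k) j0 / be.
pose v l := B i0 (lift j0 l) / be.
(* The Schur complement of be = B i0 j0. *)
pose B' := \matrix_(k, l) (B (lift i0 k) (lift j0 l) - be * u k * v l).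
pose w' := \matrix_(k, l) w (lift i0 k) (lift j0 l).
have uE k : B (lift i0 k) j0 = be * u k by rewrite /u mulrC divfK.
have vE l : B i0 (lift j0 l) = be * v l by rewrite /v mulrC divfK.
have sumL (f : 'I_m.+1 -> K) : \sum_i f i = f i0 + \sum_k f (lift i0 k).
  by rewrite (bigD1_ord i0).
have sumR (f : 'I_n.+1 -> K) : \sum_j f j = f j0 + \sum_l f (lift j0 l).
  by rewrite (bigD1_ord j0).
(* Orthogonality of the rows of w to the row i0 of B. *)
have wj0 i : w i j0 = - \sum_l w i (lift j0 l) * v l.
  apply: (mulIf b0); have := wBE i i0; rewrite sumR -/be => /eqP.
  rewrite addr_eq0 => /eqP ->; rewrite mulNr mulr_suml; congr (- _).
  by apply: eq_bigr => l _; rewrite vE; ring.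
(* Orthogonality of the columns of w to the column j0 of B. *)
have wi0 j : w i0 j = - \sum_k w (lift i0 k) j * u k.
  apply: (mulIf b0); have := BwE j j0; rewrite sumL -/be => /eqP.
  rewrite addr_eq0 => /eqP ->; rewrite mulNr mulr_suml; congr (- _).
  by apply: eq_bigr => l _; rewrite uE; ring.
have [|||s [k [ss k0 gB gw w1]]] := IH n B' w'.
- apply/matrixP => i i'; rewrite !mxE.
  under eq_bigr do rewrite !mxE.
  have := wBE (lift i0 i) (lift i0 i'); rewrite sumR uE wj0 => e.
  rewrite -[RHS]e mulNr mulr_suml -sumrN -big_split /=.
  by apply: eq_bigr => l _; ring.
- apply/matrixP => j j'; rewrite !mxE.
  under eq_bigr do rewrite !mxE.
  have := BwE (lift j0 j) (lift j0 j'); rewrite sumL vE wi0 => e.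
  rewrite -[RHS]e mulNr mulr_suml -sumrN -big_split /=.
  by apply: eq_bigr => l _; ring.
- apply: contraNneq w0 => w'0.
  have w'z k l : w (lift i0 k) (lift j0 l) = 0.
    by have /matrixP/(_ k l) := w'0; rewrite !mxE.
  have wi0z l : w i0 (lift j0 l) = 0.
    by rewrite wi0 big1 ?oppr0 // => k _; rewrite w'z mul0r.
  apply/eqP/matrixP => i j; rewrite mxE.
  have wl i' l : w i' (lift j0 l) = 0.
    by case: (unliftP i0 i') => [k ->|->].
  case: (unliftP j0 j) => [l -> //|->].
  by rewrite wj0 big1 ?oppr0 // => l _; rewrite wl mul0r.
pose s' := s ++ be :: [seq u x | x in 'I_m] ++ [seq v x | x in 'I_n].
have ss' : {subset s <= s'} by move=> x xs; rewrite mem_cat xs.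
have gbe : subring_gen s' be by apply: gen_in; rewrite mem_cat in_cons eqxx orbT.
have gu x : subring_gen s' (u x).
  by apply: gen_in; rewrite mem_cat in_cons mem_cat mem_image_fun ?orbT.
have gv x : subring_gen s' (v x).
  by apply: gen_in; rewrite mem_cat in_cons mem_cat [in X in _ || X]mem_image_fun ?orbT.
have gw' i j : subring_gen s' (k * w (lift i0 i) (lift j0 j)).
  by have := genS ss' (gw i j); rewrite mxE.
have gwl i l : subring_gen s' (k * w i (lift j0 l)).
  case: (unliftP i0 i) => [i' -> //|->].
  rewrite wi0 mulrN mulr_sumr; apply: genN; apply: gen_sum => i' _.
  by rewrite mulrA; apply: genM.
exists s', k; split=> //.
- by rewrite size_cat /= size_cat !size_image !card_ord mulSn mulnS; lia.
- move=> i j; case: (unliftP i0 i) => [i' ->|->]; case: (unliftP j0 j) => [j' ->|->] //.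
  + have := genS ss' (gB i' j'); rewrite mxE => g.
    rewrite -[B _ _](subrK (be * u i' * v j')); apply: genD => //.
    exact: genM (genM gbe (gu _)) (gv _).
  + by rewrite uE; exact: genM gbe (gu _).
  + by rewrite vE; exact: genM gbe (gv _).
- move=> i j; case: (unliftP j0 j) => [j' -> //|->].
  rewrite wj0 mulrN mulr_sumr; apply: genN; apply: gen_sum => j' _.
  by rewrite mulrA; apply: genM.
by have [i [j]] := w1; rewrite mxE => e; exists (lift i0 i), (lift j0 j).
Qed.

End ConormalPairs.

(** Take for A a family with algebraically independent entries, and normalize y
    by y l0 = 1.  Then A l0 is determined by B and the other y l *: A l.
    For l <> l0 the contribution to the parameters is mn: all entries of A l if
    y l = 0, and otherwise y l together with all entries of A l but the one at
    which w is 1, since orthogonality to w recovers it.  With the < mn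
    parameters of (B, w) the total is less than N m n. *)
Lemma exists_transverse_family (K : numClosedFieldType) (unc : uncountable K) N m n :
  exists A : 'I_N -> 'M[K]_(m, n), forall (y : 'I_N -> K) (w : 'M[K]_(m, n)) l0,
    y l0 != 0 -> w != 0 ->
    (forall l, y l != 0 -> \sum_i \sum_j w i j * A l i j = 0) ->
    w *m (\sum_l y l *: A l)^T = 0 -> w^T *m (\sum_l y l *: A l) = 0 -> False.
Proof.
pose T := ('I_N * 'I_m * 'I_n)%type.
have [x xind] := exists_alg_indep unc #|{: T}|.
pose A l : 'M[K]_(m, n) := \matrix_(i, j) x (enum_rank (l, i, j)).
exists A => y w l0 yl0 w0 wA wB Bw.
pose c l := (y l0)^-1 * y l.
set B := \sum_l y l *: A l in wB Bw.
have [| |s [k [ss k0 gB gw [a [b wab]]]]] := conormal_pair_gen (B := (y l0)^-1 *: B) (w := w) _ _ w0.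
- by rewrite linearZ -scalemxAr wB scaler0.
- by rewrite -scalemxAr Bw scaler0.
(* The mn parameters contributed by A l, for l != l0. *)
pose ent l := if y l == 0 then [seq A l p.1 p.2 | p in {: 'I_m * 'I_n}]
  else c l :: [seq A l p.1 p.2 | p in predC1 (a, b)].
have size_ent l : size (ent l) = (m * n)%N.
  rewrite /ent; case: ifP => _ /=; rewrite size_image ?cardC1 card_prod !card_ord //.
  by rewrite prednK // muln_gt0 (leq_ltn_trans _ (ltn_ord a)) // (leq_ltn_trans _ (ltn_ord b)).
pose s' := s ++ flatten [seq ent l | l in predC1 l0].
have gent l z : l != l0 -> z \in ent l -> subring_gen s' z.
  move=> ll0 zl; apply: gen_in; rewrite mem_cat; apply/orP; right.
  by apply/flattenP; exists (ent l) => //; apply/mapP; exists l; rewrite // mem_enum.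
have gs z : subring_gen s z -> subring_gen s' z by apply: genS => ? zs; rewrite mem_cat zs.
have gA l i j : l != l0 -> subring_gen s' (A l i j).
  move=> ll0; have [yl|yl] := eqVneq (y l) 0.
    apply: (gent l) => //; rewrite /ent yl eqxx.
    exact: (@mem_image_fun _ _ (fun p => A l p.1 p.2) _ (i, j)).
  have gne i' j' : (i', j') != (a, b) -> subring_gen s' (A l i' j').
    move=> ne; apply: (gent l) => //; rewrite /ent (negPf yl) in_cons.
    by rewrite (@mem_image_fun _ _ (fun p => A l p.1 p.2) _ (i', j')) ?orbT.
  have [[-> ->]|/gne //] := eqVneq (i, j) (a, b).
  have := wA l yl; rewrite pair_big (bigD1 (a, b)) //= => /(congr1 ( *%R k)).
  rewrite mulrDr mulrA wab mul1r mulr0 => /eqP; rewrite addr_eq0 => /eqP ->.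
  apply: genN; rewrite mulr_sumr; apply: gen_sum => -[i' j'] /= ne.
  by rewrite mulrA; apply: genM; [exact: gs|exact: gne].
have gc l : l != l0 -> subring_gen s' (c l).
  move=> ll0; have [yl|yl] := eqVneq (y l) 0.
    by rewrite /c yl mulr0; exact: gen0.
  by apply: (gent l) => //; rewrite /ent (negPf yl) in_cons eqxx.
have gall l i j : subring_gen s' (A l i j).
  have [->|] := eqVneq l l0; last exact: gA.
  have -> : A l0 i j = ((y l0)^-1 *: B) i j - \sum_(l | l != l0) c l * A l i j.
    rewrite !mxE summxE (bigD1 l0) //= mulrDr mxE mulrA mulVf // mul1r mulr_sumr.
    rewrite -[in RHS]addrA -sumrB big1 ?addr0 ?mxE // => l' _.
    by rewrite !mxE /c; ring.
  apply: genB; first exact: gs.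
  by apply: gen_sum => l' ll'; apply: genM; [exact: gc|exact: gA].
have : (#|{: T}| <= size s')%N.
  apply: (alg_indep_gen xind) => e; have := gall (enum_val e).1.1 (enum_val e).1.2 (enum_val e).2.
  by rewrite mxE -!surjective_pairing enum_valK.
rewrite size_cat size_flatten /shape -map_comp sumnE big_map big_enum /=.
under eq_bigr do rewrite /= size_ent.
rewrite sum_nat_const cardC1 !card_prod !card_ord.
have N0 : (0 < N)%N by exact: leq_ltn_trans (ltn_ord l0).
by rewrite -mulnA leqNgt -{2}(prednK N0) mulSn ltn_add2r ss.
Qed.

(** * Tangent spaces of the orbits and their maximal minors *)

Section OrbitTangent.
Variables (N m n : nat).

(** The index set of a generating family of the sum of the image of the
    differential and of the tangent space to the orbit: the partial derivatives,
    the E_ik B and the B E_kl. *)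
Definition tindex : finType := ('I_N + 'I_m * 'I_m + 'I_n * 'I_n)%type.

Section Ring.
Variable R : comNzRingType.
Implicit Types (B : 'M[R]_(m, n)) (D : 'I_N -> 'M[R]_(m, n)).

Definition tgen B D (k : tindex) : 'M[R]_(m, n) :=
  match k with
  | inl (inl j) => D j
  | inl (inr (i, i')) => delta_mx i i' *m B
  | inr (j, j') => B *m delta_mx j j'
  end.

Definition tminor B D (f : {ffun 'I_(m * n) -> tindex}) : R :=
  \det (\matrix_a mxvec (tgen B D (f a))).

End Ring.

Lemma map_tgen (R S : comNzRingType) (h : {rmorphism R -> S})
    (B : 'M[R]_(m, n)) D k :
  map_mx h (tgen B D k) = tgen (map_mx h B) (fun j => map_mx h (D j)) k.
Proof.
by case: k => [[j|[i i']]|[j j']] //=; rewrite map_mxM map_delta_mx.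
Qed.

Lemma map_tminor (R S : comNzRingType) (h : {rmorphism R -> S})
    (B : 'M[R]_(m, n)) D f :
  h (tminor B D f) = tminor (map_mx h B) (fun j => map_mx h (D j)) f.
Proof.
rewrite /tminor -det_map_mx; congr (\det _); apply/row_matrixP => a.
by rewrite -map_row !rowK map_mxvec map_tgen.
Qed.

Section Field.
Variable F : fieldType.
Implicit Types (B w : 'M[F]_(m, n)) (D : 'I_N -> 'M[F]_(m, n)).

Lemma tminor_spans B D f : tminor B D f != 0 -> forall w,
  exists (u : 'I_N -> F) P Q, w = \sum_j u j *: D j + (P *m B + B *m Q).
Proof.
move=> nz w; set M : 'M[F]_(m * n) := \matrix_a mxvec (tgen B D (f a)).
have uM : M \in unitmx by rewrite unitmxE unitfE.
have -> : w = \sum_a ((mxvec w *m invmx M) 0 a) *: tgen B D (f a).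
  apply: (can_inj mxvecK); rewrite raddf_sum /= -[LHS](mulmxKV uM) mulmx_sum_row.
  by apply: eq_bigr => a _; rewrite linearZ /= rowK.
elim/big_ind: _ => [|x y [u [P [Q ->]]] [u' [P' [Q' ->]]]|a _].
- exists (fun _ => 0), 0, 0; rewrite mul0mx mulmx0 !addr0 big1 // => j _.
  by rewrite scale0r.
- exists (fun j => u j + u' j), (P + P'), (Q + Q').
  under [in RHS]eq_bigr do rewrite scalerDl.
  by rewrite big_split /= mulmxDl mulmxDr addrACA; congr (_ + _); rewrite addrACA.
set c := (_ *m _) 0 a; case: (f a) => [[j|[i i']]|[j j']] /=.
- exists (fun l => if l == j then c else 0), 0, 0; rewrite mul0mx mulmx0 !addr0.
  by rewrite (bigD1 j) //= eqxx big1 ?addr0 // => l /negPf->; rewrite scale0r.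
- exists (fun _ => 0), (c *: delta_mx i i'), 0; rewrite mulmx0 addr0 scalemxAl.
  by rewrite big1 ?add0r // => l _; rewrite scale0r.
- exists (fun _ => 0), 0, (c *: delta_mx j j'); rewrite mul0mx add0r scalemxAr.
  by rewrite big1 ?add0r // => l _; rewrite scale0r.
Qed.

(** The rows of a matrix of rank < mn all lie in a hyperplane w^perp.
    Orthogonality to all E_ik B and B E_kl amounts to the two matrix equations.
*)
Lemma tminors_eq0 B D : (forall f, tminor B D f = 0) ->
  exists2 w : 'M[F]_(m, n), w != 0 & [/\ forall j, \sum_a \sum_b w a b * D j a b = 0,
    w *m B^T = 0 & w^T *m B = 0].
Proof.
move=> z; pose G : 'M[F]_(#|tindex|, m * n) := \matrix_k mxvec (tgen B D (enum_val k)).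
have rG : (\rank G < m * n)%N.
  rewrite ltn_neqAle rank_leq_col andbT; apply/negP => fG.
  have := fullrowsub_unit fG; set f := fullrankfun fG => uf.
  have := z [ffun a => enum_val (f a)]; rewrite /tminor => /eqP; apply/negP.
  rewrite -unitfE -unitmxE (_ : \matrix_a _ = rowsub f G) //.
  by apply/row_matrixP => a; rewrite row_rowsub !rowK ffunE.
have : kermx G^T != 0.
  by rewrite -mxrank_eq0 mxrank_ker mxrank_tr subn_eq0 -ltnNge.
case/rowV0Pn => v /sub_kermxP vG v0; pose w : 'M[F]_(m, n) := vec_mx v.
have wG k : \sum_a \sum_b w a b * tgen B D k a b = 0.
  have /matrixP/(_ 0 (enum_rank k)) := vG; rewrite !mxE => e; rewrite -[RHS]e.
  rewrite pair_big (reindex _ (curry_mxvec_bij m n)) /=.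
  by apply: eq_bigr => -[a b] _ /=; rewrite !mxE enum_rankK mxvecE.
exists w; first by rewrite -(can_eq vec_mxK) linear0 in v0 *.
split; first by move=> j; apply: (wG (inl (inl j))).
  apply/matrixP => i i'; rewrite !mxE -[RHS](wG (inl (inr (i, i')))).
  rewrite /= (bigD1 i) //= [X in _ = _ + X]big1 ?addr0.
    apply: eq_bigr => b _; rewrite !mxE (bigD1 i') //= !mxE !eqxx mul1r.
    by rewrite big1 ?addr0 // => l /negPf ne; rewrite mxE ne andbF mul0r.
  move=> a /negPf ai; rewrite big1 // => b _; rewrite [X in _ * X]mxE big1 ?mulr0 // => l _.
  by rewrite mxE ai mul0r.
apply/matrixP => j j'; rewrite !mxE -[RHS](wG (inr (j', j))) exchange_big /=.
rewrite (bigD1 j) //= [X in _ = _ + X]big1 ?addr0.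
  apply: eq_bigr => b _; rewrite !mxE (bigD1 j') //= !mxE !eqxx mulr1.
  by rewrite big1 ?addr0 // => l /negPf ne; rewrite mxE ne mulr0.
move=> a /negPf ai; rewrite big1 // => b _; rewrite [X in _ * X]mxE big1 ?mulr0 // => l _.
by rewrite mxE ai andbF mulr0.
Qed.

End Field.
End OrbitTangent.

(** * Leading forms and finite colength *)

Section Leading.
Variables (N : nat) (F : fieldType).
Implicit Types p q : mpoly N F.

Lemma msize_leP p d :
  reflect (forall a, (d <= mdeg a)%N -> mcoeff a p = 0) (msz p <= d)%N.
Proof.
apply: (iffP idP) => [pd a da|h].
  by apply: memN_msupp_eq0; apply: msize_mdeg_ge; apply: leq_trans da.
rewrite /= msizeE; apply/bigmax_leqP_seq => a ap _; rewrite ltnNge.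
by apply/negP => /h/eqP; rewrite mcoeff_eq0 ap.
Qed.

Lemma msizeB_le p q d : (msz p <= d)%N -> (msz q <= d)%N -> (msz (p - q) <= d)%N.
Proof.
move=> /msize_leP pd /msize_leP qd; apply/msize_leP => a da.
by rewrite mcoeffB pd // qd // subr0.
Qed.

Lemma msize_add_le p q d : (msz p <= d)%N -> (msz q <= d)%N -> (msz (p + q) <= d)%N.
Proof. by move=> pd qd; rewrite -[q]opprK msizeB_le // mmeasureN. Qed.

Lemma msize_sum_le (I : Type) (r : seq I) (P : pred I) (f : I -> mpoly N F) d :
  (forall i, P i -> (msz (f i) <= d)%N) -> (msz (\sum_(i <- r | P i) f i) <= d)%N.
Proof.
move=> fd; elim/big_ind: _ => //; first by rewrite mmeasure0.
by move=> p q; exact: msize_add_le.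
Qed.

Lemma msize_mul_le p q d e :
  (msz p <= d)%N -> (msz q <= e.+1)%N -> (msz (p * q) <= d + e)%N.
Proof.
have [->|p0] := eqVneq p 0; first by rewrite mul0r mmeasure0.
have [->|q0] := eqVneq q 0; first by rewrite mulr0 mmeasure0.
by rewrite msizeM // => pd qe; have := leq_add pd qe; rewrite addnS; case: (_ + _)%N.
Qed.

Lemma homog_msize_le p d : p \is homog d -> (msz p <= d.+1)%N.
Proof.
move=> hp; apply/msize_leP => a da; apply: (dhomog_nemf_coeff hp).
by rewrite gtn_eqF.
Qed.

(** q is the homogeneous part of degree e of p, which has degree at most e; the
    case q = 0 is included. *)
Definition leading e p q := q \is homog e /\ (msz (p - q) <= e)%N.

Lemma leading0 e : leading e 0 0.
Proof. by split; [exact: rpred0|rewrite subr0 mmeasure0]. Qed.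

Lemma leadingD e p q p' q' :
  leading e p q -> leading e p' q' -> leading e (p + p') (q + q').
Proof.
move=> [hq pq] [hq' pq']; split; first exact: rpredD.
by rewrite opprD addrACA msize_add_le.
Qed.

Lemma leadingM d e p q p' q' :
  leading d p q -> leading e p' q' -> leading (d + e) (p * p') (q * q').
Proof.
move=> [hq pq] [hq' pq']; split; first exact: dhomogM.
have p'e : (msz p' <= e.+1)%N.
  by rewrite -[p'](subrK q'); apply: msize_add_le; [exact: leqW|exact: homog_msize_le].
have -> : p * p' - q * q' = (p - q) * p' + (p' - q') * q by ring.
apply: msize_add_le; first exact: msize_mul_le.
by rewrite addnC; apply: msize_mul_le => //; exact: homog_msize_le.
Qed.

Lemma leading_const c : leading 0 (mpolyC N c) (mpolyC N c).
Proof.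
split; last by rewrite subrr mmeasure0.
by rewrite -alg_mpolyC; apply: rpredZ; exact: dhomog1.
Qed.

Lemma leading_sum (I : Type) (r : seq I) e (p q : I -> mpoly N F) :
  (forall i, leading e (p i) (q i)) ->
  leading e (\sum_(i <- r) p i) (\sum_(i <- r) q i).
Proof.
by move=> pq; elim/big_ind2: _ => //; [exact: leading0|move=> *; exact: leadingD].
Qed.

Lemma leading_prod (I : Type) (r : seq I) (e : I -> nat) (p q : I -> mpoly N F) :
  (forall i, leading (e i) (p i) (q i)) ->
  leading (\sum_(i <- r) e i) (\prod_(i <- r) p i) (\prod_(i <- r) q i).
Proof.
move=> pq; elim: r => [|i r IH].
  by rewrite !big_nil -mpolyC1; exact: leading_const.
by rewrite !big_cons; apply: leadingM.
Qed.

Lemma leading_deriv e p q j :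
  leading e p q -> leading e.-1 (mderiv j p) (mderiv j q).
Proof.
move=> [hq /msize_leP pq]; split.
  apply/dhomogP => a; rewrite mcoeff_msupp mcoeff_deriv => nz.
  have : mcoeff (mnm_add a (mnm1 j)) q != 0.
    by apply: contraNneq nz => ->; rewrite mul0rn.
  rewrite -mcoeff_msupp => /(dhomog_mf hq) <-.
  by rewrite /= mdegD mdeg1 addn1.
apply/msize_leP => a ea; rewrite -mderivB mcoeff_deriv pq ?mul0rn //.
by rewrite mdegD mdeg1; lia.
Qed.

Lemma pihomogM_homog (c q : mpoly N F) d e : q \is homog e ->
  pihomog mdeg d (c * q) = if (e <= d)%N then pihomog mdeg (d - e) c * q else 0.
Proof.
move=> hq; rewrite {1}(pihomog_partitionE (leqnn (msz c))) mulr_suml raddf_sum /=.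
have hi i : pihomog mdeg i c * q \is homog (i + e) by apply: dhomogM => //; exact: pihomogP.
have z i : (i + e)%N != d -> pihomog mdeg d (pihomog mdeg i c * q) = 0.
  by move=> ne; rewrite (pihomog_ne0 ne).
case: ifP => [ed|/negbT]; last first.
  rewrite -ltnNge => de; rewrite big1 // => i _; apply: z; apply: contraTneq de => <-.
  by rewrite -leqNgt leq_addl.
have [lt|ge] := ltnP (d - e) (msz c).
  rewrite (bigD1 (Ordinal lt)) //= big1 ?addr0.
    by rewrite pihomog_dE // -{2}(subnK ed).
  move=> i ni; apply: z; apply: contraNneq ni => h; apply/eqP/val_inj => /=.
  by rewrite -h addnK.
rewrite big1; last first.
  move=> i _; apply: z; apply: contraTneq ge => h; rewrite -ltnNge.
  by rewrite -h addnK.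
suff -> : pihomog mdeg (d - e) c = 0 by rewrite mul0r.
rewrite pihomogE big_seq_cond big_pred0 // => a; apply/negbTE/negP => /andP[ac /eqP ad].
by have := msize_mdeg_lt ac; rewrite ltnNge -ad in ge *; rewrite ge.
Qed.

End Leading.

Section PolynomialMatrices.
Variables (N m n : nat) (F : fieldType).
Implicit Types (M G : 'M[mpoly N F]_(m, n)) (f : {ffun 'I_(m * n) -> tindex N m n}).

Definition pminor M f : mpoly N F := tminor M (fun j => map_mx (mderiv j) M) f.

Definition minor_ideal M (p : mpoly N F) : Prop :=
  exists c : {ffun 'I_(m * n) -> tindex N m n} -> mpoly N F, p = \sum_f c f * pminor M f.

Lemma minor_idealP M : is_ideal (minor_ideal M).
Proof.
split; first by exists (fun _ => 0); rewrite big1 // => f _; rewrite mul0r.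
  move=> p q [c ->] [d ->]; exists (fun f => c f + d f).
  by rewrite -big_split; apply: eq_bigr => f _; rewrite mulrDl.
move=> p q [c ->]; exists (fun f => p * c f); rewrite mulr_sumr.
by apply: eq_bigr => f _; rewrite mulrA.
Qed.

Lemma minor_ideal_minor M f : minor_ideal M (pminor M f).
Proof.
exists (fun g => if g == f then 1 else 0); rewrite (bigD1 f) //= eqxx mul1r.
by rewrite big1 ?addr0 // => g /negPf->; rewrite mul0r.
Qed.

(** The degrees of the generating vectors when the entries of the matrix have
    degree D. *)
Definition tdeg D (k : tindex N m n) : nat := if k is inl (inl _) then D.-1 else D.

Lemma leading_pminor D M G f : (forall i j, leading D (M i j) (G i j)) ->
  leading (\sum_a tdeg D (f a)) (pminor M f) (pminor G f).
Proof.
move=> MG.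
have ldelta p q (i : 'I_p) (j : 'I_q) i' j' : leading 0
    ((delta_mx i j : 'M[mpoly N F]_(p, q)) i' j') (delta_mx i j i' j').
  by rewrite mxE -(rmorph_nat (@mpolyC N F)); exact: leading_const.
have lgen k i j : leading (tdeg D k) (tgen M (fun j => map_mx (mderiv j) M) k i j)
    (tgen G (fun j => map_mx (mderiv j) G) k i j).
  case: k => [[l|[a a']]|[b b']] /=; rewrite mxE [X in leading _ _ X]mxE.
  - exact: leading_deriv.
  - by apply: leading_sum => l; rewrite -[D]add0n; apply: leadingM.
  - by apply: leading_sum => l; rewrite -[D]addn0; apply: leadingM.
apply: leading_sum => s; rewrite -[(\sum_a _)%N]add0n; apply: leadingM.
  by rewrite -(rmorph_sign (@mpolyC N F)); exact: leading_const.
apply: leading_prod => a; rewrite mxE [X in leading _ _ X]mxE.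
by move: (lgen (f a)); case/mxvec_indexP: (perm.fun_of_perm s a) => i j lg; rewrite !mxvecE.
Qed.

(** A monomial of degree d >= s is a combination of the minors of G with
    homogeneous coefficients.  Replacing these minors by those of M changes the
    combination by terms of degree < d only, because the minors of G are the
    leading forms of those of M; one concludes by induction on d. *)
Lemma minor_ideal_reduce D s M G : (forall i j, leading D (M i j) (G i j)) ->
  (forall a, (s <= mdeg a)%N -> minor_ideal G (mpolyX F a)) ->
  forall p, exists2 r, (msz r <= s)%N & minor_ideal M (p - r).
Proof.
move=> MG Gs; have idM := minor_idealP M.
suff mon a : exists2 r, (msz r <= s)%N & minor_ideal M (mpolyX F a - r).
  move=> p; elim/mpolyind: p => [|c a p _ _ [r rs Mr]].
    by exists 0; rewrite ?mmeasure0 // subrr; apply: ideal0.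
  have [r' r's Mr'] := mon a; exists (c *: r' + r).
    by apply: msize_add_le => //; apply: leq_trans (msizeZ_le _ _) _.
  have := idealD idM (idealM idM (mpolyC N c) Mr') Mr.
  by congr minor_ideal; rewrite -!mul_mpolyC; ring.
have [d] := ubnP (mdeg a); elim: d a => // d IH a; rewrite ltnS => ad.
have [as_|sa] := ltnP (mdeg a) s.
  by exists (mpolyX F a); [rewrite mmeasureX|rewrite subrr; apply: ideal0].
have [c cE] := Gs a sa.
pose e f := (\sum_x tdeg D (f x))%N.
have lead f := leading_pminor f MG.
(* The part of c f that contributes to the degree of the monomial. *)
pose c' f := if (e f <= mdeg a)%N then pihomog mdeg (mdeg a - e f) (c f) else 0.
have aE : mpolyX F a = \sum_f c' f * pminor G f.
  have -> : mpolyX F a = pihomog mdeg (mdeg a) (mpolyX F a).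
    by rewrite pihomogX eqxx.
  rewrite cE raddf_sum /=; apply: eq_bigr => f _.
  rewrite (pihomogM_homog _ _ (lead f).1) /c' -/(e f).
  by case: ifP => //; rewrite mul0r.
pose r := mpolyX F a - \sum_f c' f * pminor M f.
have rE : r = - \sum_f c' f * (pminor M f - pminor G f).
  rewrite /r aE; under [in RHS]eq_bigr do rewrite mulrBr.
  by rewrite sumrB opprB.
have rd : (msz r <= mdeg a)%N.
  rewrite rE mmeasureN; apply: msize_sum_le => f _; rewrite /c'.
  case: ifP => [ea|_]; last by rewrite mul0r mmeasure0.
  rewrite mulrC -[X in (_ <= X)%N](subnKC ea); apply: msize_mul_le.
    exact: (lead f).2.
  by apply: homog_msize_le; exact: pihomogP.
have Mar : minor_ideal M (mpolyX F a - r).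
  exists c'; rewrite /r; set S := \sum_f c' f * pminor M f.
  rewrite opprB addrC subrK; reflexivity.
suff [r' r's Mr'] : exists2 r', (msz r' <= s)%N & minor_ideal M (r - r').
  by exists r' => //; have := idealD idM Mar Mr'; congr minor_ideal; ring.
rewrite [r]mpolyE big_seq.
elim/big_ind: _ => [|x y [x' xs Mx] [y' ys My]|b br].
- by exists 0; rewrite ?mmeasure0 // subrr; apply: ideal0.
- exists (x' + y'); first exact: msize_add_le.
  by have := idealD idM Mx My; congr minor_ideal; ring.
have [|b' b's Mb] := IH b.
  by apply: leq_trans ad; apply: leq_trans rd; apply: msize_mdeg_lt.
exists (mcoeff b r *: b'); first exact: leq_trans (msizeZ_le _ _) _.
have := idealM idM (mpolyC N (mcoeff b r)) Mb.
by congr minor_ideal; rewrite -!mul_mpolyC; ring.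
Qed.

End PolynomialMatrices.

Section FermatMatrix.
Variables (K : numClosedFieldType) (unc : uncountable K) (N m n : nat).

Definition fermat (A : 'I_N -> 'M[K]_(m, n)) D : 'M[mpoly N K]_(m, n) :=
  \matrix_(i, j) \sum_l A l i j *: mpolyX K (mnm_muln (mnm1 l) D).

(** At a common zero v, the derivatives of the matrix are nonzero multiples of
    the A l with v l <> 0, so the covector w obtained there contradicts the
    general position of A. *)
Lemma exists_homogeneous_finite D : (0 < D)%N ->
  exists (G : 'M[mpoly N K]_(m, n)) s, (forall i j, G i j \is homog D) /\
    forall a, (s <= mdeg a)%N -> minor_ideal G (mpolyX K a).
Proof.
move=> D0; have [A Aprop] := exists_transverse_family unc N m n.
exists (fermat A D).
have [|s sP] := ideal_monomials unc (minor_idealP (fermat A D)); last first.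
  exists s; split=> // i j; rewrite mxE; apply: rpred_sum => l _; apply: rpredZ.
  by rewrite dhomogX /= mdegMn mdeg1 mul1n.
move=> v vz i; apply: contrapT => /eqP vi.
pose y l := v l ^+ D.
have evG : map_mx (meval v) (fermat A D) = \sum_l y l *: A l.
  apply/matrixP => a b; rewrite !mxE raddf_sum summxE /=; apply: eq_bigr => l _.
  by rewrite mevalZ -mpolyXn rmorphXn /= mevalXU !mxE mulrC.
have evD j : map_mx (meval v) (map_mx (mderiv j) (fermat A D)) =
    (D%:R * v j ^+ D.-1) *: A j.
  apply/matrixP => a b; rewrite !mxE (raddf_sum (mderiv j)) (raddf_sum (meval v)) (bigD1 j) //=.
  rewrite big1 ?addr0 => [|l lj].
    rewrite mderivZ mderivX mulmnE mnm1E eqxx mul1n scalerA mevalZ mulrC mulrCA.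
    rewrite (_ : mnm_sub _ _ = mnm_muln (mnm1 j) D.-1) -?mpolyXn ?rmorphXn /= ?mevalXU; first by ring.
    by apply/mnmP => x; rewrite mnmBE !mulmnE; case: (D) D0 => // D' _; rewrite mulnSr addnK.
  rewrite mderivZ mderivX mulmnE mnm1E (negPf lj) mul0n scale0r scaler0.
  by rewrite raddf0.
have [f|w w0 [wD wB Bw]] := @tminors_eq0 N m n K (\sum_l y l *: A l)
  (fun j => (D%:R * v j ^+ D.-1) *: A j).
  have := vz _ (minor_ideal_minor (fermat A D) f).
  rewrite /pminor (map_tminor (meval v)) evG.
  by congr (_ = _); congr tminor; apply/funext => j; rewrite evD.
apply: (Aprop y w i) => //; first by rewrite expf_neq0.
move=> l yl; have vl : v l != 0 by apply: contraNneq yl => e; rewrite /y e expr0n gtn_eqF.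
have := wD l; under eq_bigr do under eq_bigr do rewrite mxE mulrCA.
under eq_bigr do rewrite -mulr_sumr.
by rewrite -mulr_sumr => /eqP; rewrite !mulf_eq0 expf_eq0 (negPf vl) andbF pnatr_eq0 gtn_eqF // => /eqP.
Qed.

End FermatMatrix.

(** * A polynomial certificate for finite colength *)

Section MatrixRank.
Variable F : fieldType.

Lemma exists_full_minor p q (A : 'M[F]_(p, q)) :
  exists (f : 'I_(\rank A) -> 'I_p) (g : 'I_(\rank A) -> 'I_q),
    \det (mxsub f g A) != 0.
Proof.
have full : row_full (rowsub (maxrankfun A) A)^T.
  by rewrite /row_full mxrank_tr; exact: maxrowsub_free.
exists (maxrankfun A), (fullrankfun full).
have := fullrowsub_unit full; rewrite -unitmx_tr unitmxE unitfE.
rewrite (_ : _^T = mxsub (maxrankfun A) (fullrankfun full) A) //.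
by apply/matrixP => i j; rewrite !mxE.
Qed.

Lemma minor_rank p q k (A : 'M[F]_(p, q)) (f : 'I_k -> 'I_p) (g : 'I_k -> 'I_q) :
  \det (mxsub f g A) != 0 -> (k <= \rank A)%N.
Proof.
rewrite -unitfE -unitmxE -row_free_unit /row_free => /eqP <-.
have -> : mxsub f g A = rowsub f A *m colsub g 1%:M.
  apply/matrixP => i j; rewrite !mxE (bigD1 (g j)) //= !mxE eqxx mulr1 big1 ?addr0 //.
  by move=> l /negPf ne; rewrite !mxE ne mulr0.
by apply: leq_trans (mxrankM_maxl _ _) _; apply: mxrankS; exact: rowsub_sub.
Qed.

(** W spans a subspace of codimension < l in a space graded by degrees < l.
    Adding to it the vectors of degree >= j, for j = l, ..., 0, gives l + 1
    subspaces whose codimension goes from a number < l down to 0, so two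
    consecutive ones coincide: every vector of degree j is in the span of W
    up to terms of higher degree. *)
Lemma graded_step p q (W : 'M[F]_(p, q)) (deg : 'I_q -> nat) l :
    (q < \rank W + l)%N -> (forall b, (deg b < l)%N) ->
  exists2 j, (j < l)%N & forall b, deg b = j -> exists u : 'rV_p,
    forall b', (deg b' <= j)%N -> (u *m W) 0 b' = (b == b')%:R.
Proof.
move=> rW degl; pose V j : 'M[F]_q := diag_mx (\row_b (j <= deg b)%:R).
pose d j := \rank (W + V j)%MS.
have VS j : (V j.+1 <= V j)%MS.
  apply/submxP; exists (V j.+1); rewrite mulmx_diag; apply/matrixP => a b; rewrite !mxE.
  by congr (_ *+ _); case: ltnP => [/ltnW->|_]; rewrite ?mulr1 // mul0r.
have dl : d l = \rank W.
  rewrite /d (_ : V l = 0) ?addsmx0 //; apply/matrixP => a b; rewrite !mxE.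
  by rewrite leqNgt degl mul0rn.
have [j jl dj] : exists2 j, (j < l)%N & (d j <= d j.+1)%N.
  apply: contrapT => nodj.
  have ddec j : (j < l)%N -> (d j.+1 < d j)%N.
    by move=> jl; rewrite ltnNge; apply/negP => dj; apply: nodj; exists j.
  have : forall k, (k <= l)%N -> (d k + k <= q)%N.
    elim=> [_|k IH kl]; first by rewrite addn0 rank_leq_col.
    by have := IH (ltnW kl); have := ddec k kl; lia.
  by move=> /(_ l (leqnn l)); rewrite dl leqNgt rW.
exists j => // b bj.
have VV : (W + V j <= W + V j.+1)%MS.
  have le : (W + V j.+1 <= W + V j)%MS by rewrite addsmxS.
  by rewrite -(geq_leqif (mxrank_leqif_sup le)).
have eb : (delta_mx 0 b : 'rV_q) = row b (V j).
  apply/rowP => b'; rewrite !mxE bj leqnn; by case: (eqVneq b b'); rewrite eqxx.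
have : (delta_mx (0 : 'I_1) b <= W + V j.+1)%MS.
  by apply: submx_trans VV; apply: submx_trans (addsmxSr _ _); rewrite eb row_sub.
case/sub_addsmxP => -[u v] /= /matrixP uv; exists u => b' b'j.
have := uv 0 b'; rewrite mxE eqxx /= [RHS]mxE eq_sym => ->.
rewrite [X in _ = _ + X]mxE big1 ?addr0 // => c _; rewrite !mxE.
case: eqVneq => [->|]; last by rewrite mulr0n mulr0.
by rewrite ltnNge b'j mulr0.
Qed.

End MatrixRank.

Section PolynomialFunctions.
Variables (K : comNzRingType) (I : finType).
Implicit Types (phi psi : {ffun I -> K} -> K).

Definition polyfun phi : Prop :=
  exists q : mpoly #|I| K, forall z : {ffun I -> K}, meval (fun k => z (enum_val k)) q = phi z.

Lemma polyfun_const c : polyfun (fun _ => c).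
Proof. by exists (mpolyC _ c) => z; rewrite mevalC. Qed.

Lemma polyfun_coord i : polyfun (fun z => z i).
Proof. by exists (mpolyX _ (mnm1 (enum_rank i))) => z; rewrite mevalXU enum_rankK. Qed.

Lemma polyfunD phi psi : polyfun phi -> polyfun psi -> polyfun (fun z => phi z + psi z).
Proof. by move=> [p pE] [q qE]; exists (p + q) => z; rewrite mevalD pE qE. Qed.

Lemma polyfunM phi psi : polyfun phi -> polyfun psi -> polyfun (fun z => phi z * psi z).
Proof. by move=> [p pE] [q qE]; exists (p * q) => z; rewrite mevalM pE qE. Qed.

Lemma polyfun_ext phi psi : polyfun phi -> phi =1 psi -> polyfun psi.
Proof. by move=> [p pE] e; exists p => z; rewrite pE e. Qed.

Lemma polyfun_sum (J : Type) (r : seq J) (P : pred J) (f : J -> {ffun I -> K} -> K) :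
  (forall j, polyfun (f j)) -> polyfun (fun z => \sum_(j <- r | P j) f j z).
Proof.
move=> fP; elim: r => [|j r IH].
  by apply: polyfun_ext (polyfun_const 0) _ => z; rewrite big_nil.
case Pj : (P j).
  by apply: polyfun_ext (polyfunD (fP j) IH) _ => z; rewrite big_cons Pj.
by apply: polyfun_ext IH _ => z; rewrite big_cons Pj.
Qed.

Lemma polyfun_prod (J : Type) (r : seq J) (f : J -> {ffun I -> K} -> K) :
  (forall j, polyfun (f j)) -> polyfun (fun z => \prod_(j <- r) f j z).
Proof.
move=> fP; elim: r => [|j r IH].
  by apply: polyfun_ext (polyfun_const 1) _ => z; rewrite big_nil.
by apply: polyfun_ext (polyfunM (fP j) IH) _ => z; rewrite big_cons.
Qed.

Lemma polyfun_det p (M : {ffun I -> K} -> 'M[K]_p) :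
  (forall i j, polyfun (fun z => M z i j)) -> polyfun (fun z => \det (M z)).
Proof.
move=> MP; apply: polyfun_sum => s; apply: polyfunM; first exact: polyfun_const.
by apply: polyfun_prod => i; apply: MP.
Qed.

Variable N : nat.
Implicit Types P Q : {ffun I -> K} -> mpoly N K.

Definition polyfamily P : Prop := forall b, polyfun (fun z => mcoeff b (P z)).

Lemma polyfamily_const p : polyfamily (fun _ => p).
Proof. by move=> b; exact: polyfun_const. Qed.

Lemma polyfamilyM P Q : polyfamily P -> polyfamily Q -> polyfamily (fun z => P z * Q z).
Proof.
move=> hP hQ b.
apply: polyfun_ext (fun z => esym (mcoeffM (P z) (Q z) b)).
by apply: polyfun_sum => k; apply: polyfunM.
Qed.

Lemma polyfamily_ext P Q : polyfamily P -> P =1 Q -> polyfamily Q.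
Proof. by move=> hP e b; apply: polyfun_ext (hP b) _ => z; rewrite e. Qed.

Lemma polyfamily_sum (J : Type) (r : seq J) (R : pred J) (f : J -> {ffun I -> K} -> mpoly N K) :
  (forall j, polyfamily (f j)) -> polyfamily (fun z => \sum_(j <- r | R j) f j z).
Proof.
move=> fP b; apply: polyfun_ext (fun z => esym (raddf_sum (mcoeff b) _ _ _)).
by apply: polyfun_sum => j; apply: fP.
Qed.

Lemma polyfamily_prod (J : Type) (r : seq J) (f : J -> {ffun I -> K} -> mpoly N K) :
  (forall j, polyfamily (f j)) -> polyfamily (fun z => \prod_(j <- r) f j z).
Proof.
move=> fP; elim: r => [|j r IH].
  by apply: polyfamily_ext (polyfamily_const 1) _ => z; rewrite big_nil.
by apply: polyfamily_ext (polyfamilyM (fP j) IH) _ => z; rewrite big_cons.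
Qed.

Lemma polyfamily_det p (M : {ffun I -> K} -> 'M[mpoly N K]_p) :
  (forall i j, polyfamily (fun z => M z i j)) -> polyfamily (fun z => \det (M z)).
Proof.
move=> MP; apply: polyfamily_sum => s; apply: polyfamilyM; first exact: polyfamily_const.
by apply: polyfamily_prod => i; apply: MP.
Qed.

Lemma polyfamily_deriv j P : polyfamily P -> polyfamily (fun z => mderiv j (P z)).
Proof.
move=> hP b; apply: polyfun_ext (fun z => esym (mcoeff_deriv _ _ _)).
apply: polyfun_ext (polyfunM (hP _) (polyfun_const (b j).+1%:R)) _ => z.
by rewrite mulr_natr.
Qed.

Lemma polyfamily_pminor m n (M : {ffun I -> K} -> 'M[mpoly N K]_(m, n)) f :
  (forall i j, polyfamily (fun z => M z i j)) ->
  polyfamily (fun z => tminor (M z) (fun j => map_mx (mderiv j) (M z)) f).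
Proof.
move=> MP; apply: polyfamily_det => a c; case/mxvec_indexP: c => i j.
apply: (@polyfamily_ext (fun z => tgen (M z) (fun j => map_mx (mderiv j) (M z)) (f a) i j)).
  case: (f a) => [[l|[b b']]|[b b']] /=.
  - by apply: polyfamily_ext (polyfamily_deriv l (MP i j)) _ => z; rewrite mxE.
  - have h : polyfamily (fun z => \sum_l delta_mx b b' i l * M z l j).
      by apply: polyfamily_sum => l; apply: polyfamilyM => //; exact: polyfamily_const.
    by apply: polyfamily_ext h _ => z; rewrite [RHS]mxE.
  - have h : polyfamily (fun z => \sum_l M z i l * delta_mx b b' l j).
      by apply: polyfamily_sum => l; apply: polyfamilyM => //; exact: polyfamily_const.
    by apply: polyfamily_ext h _ => z; rewrite [RHS]mxE.
by move=> z; rewrite mxE mxvecE.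
Qed.

End PolynomialFunctions.

Section Certificate.
Variables (F : numFieldType) (N m n l : nat).
Local Notation J := (jet F N m n l).
Local Notation rows := (bmultinom N l * {ffun 'I_(m * n) -> tindex N m n})%type.

Definition jet_poly r (z : jet F N m n r) : 'M[mpoly N F]_(m, n) :=
  \matrix_(i, j) \sum_(a : bmultinom N r.+1) z (a, i, j) *: mpolyX F (bmnm a).

(** Its rows span the ideal of minors of the jet, modulo degree l. *)
Definition minor_table (z : J) : 'M[F]_(#|{: rows}|, #|{: bmultinom N l}|) :=
  \matrix_(x, b) mcoeff (bmnm (enum_val b))
    (mpolyX F (bmnm (enum_val x).1) * pminor (jet_poly z) (enum_val x).2).

Lemma polyfun_minor_table x b : polyfun (fun z : J => minor_table z x b).
Proof.
suff h : polyfamily (fun z : J => mpolyX F (bmnm (enum_val x).1) * pminor (jet_poly z) (enum_val x).2).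
  by apply: polyfun_ext (h _) _ => z; rewrite mxE.
apply: polyfamilyM; first exact: polyfamily_const.
apply: polyfamily_pminor => i j.
have h : polyfamily (fun z : J => \sum_(a : bmultinom N l.+1) z (a, i, j) *: mpolyX F (bmnm a)).
  apply: polyfamily_sum => a b'.
  have h := polyfunM (polyfun_coord F ((a, i, j) : bmultinom N l.+1 * 'I_m * 'I_n))
    (polyfun_const _ (mcoeff b' (mpolyX F (bmnm a)))).
  by apply: polyfun_ext h _ => z; rewrite mcoeffZ.
by apply: polyfamily_ext h _ => z; rewrite mxE.
Qed.

Lemma mcoeffM_trunc (c p : mpoly N F) b : (mdeg b < l)%N ->
  mcoeff b (c * p) = \sum_(a : bmultinom N l) mcoeff (bmnm a) c * mcoeff b (mpolyX F (bmnm a) * p).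
Proof.
move=> bl; pose c1 := \sum_(a : bmultinom N l) mcoeff (bmnm a) c *: mpolyX F (bmnm a).
have -> : mcoeff b (c * p) = mcoeff b (c1 * p).
  rewrite !mcoeffM; apply: eq_bigr => k /eqP bk; congr (_ * _).
  rewrite (mcoeff_mpoly (fun a => mcoeff a c)) //; apply: leq_ltn_trans bl.
  exact: bmdeg k.1.
rewrite /c1 mulr_suml raddf_sum /=; apply: eq_bigr => a _.
by rewrite -scalerAl mcoeffZ.
Qed.

(** Modulo the span of the rows, everything reduces to degree < s. *)
Lemma minor_table_rank s (z : J) :
  (forall p, exists2 r, (msz r <= s)%N & minor_ideal (jet_poly z) (p - r)) ->
  (#|{: bmultinom N l}| <= \rank (minor_table z) + #|{: bmultinom N s}|)%N.
Proof.
move=> red.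
pose E : 'M[F]_(#|{: bmultinom N s}|, #|{: bmultinom N l}|) :=
  \matrix_(a, b) (bmnm (enum_val a) == bmnm (enum_val b))%:R.
suff full : (1%:M <= minor_table z + E)%MS.
  have := mxrankS full; rewrite mxrank1 => h; apply: leq_trans h _.
  apply: leq_trans (mxrank_adds_leqif _ _).1 _.
  by rewrite leq_add2l rank_leq_row.
apply/row_subP => b; rewrite row1.
have [r rs [c cE]] := red (mpolyX F (bmnm (enum_val b))).
apply/sub_addsmxP.
exists (\row_x mcoeff (bmnm (enum_val x).1) (c (enum_val x).2), \row_a mcoeff (bmnm (enum_val a)) r).
apply/rowP => b'; rewrite !mxE eqxx /=.
have Xr : mpolyX F (bmnm (enum_val b)) = \sum_f c f * pminor (jet_poly z) f + r.
  by rewrite -cE subrK.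
transitivity (mcoeff (bmnm (enum_val b')) (mpolyX F (bmnm (enum_val b)))).
  by rewrite mcoeffX -bmeqP (inj_eq enum_val_inj) eq_sym.
rewrite Xr mcoeffD raddf_sum /=; congr (_ + _).
  under eq_bigr do rewrite (mcoeffM_trunc _ _ (bmdeg (enum_val b'))).
  rewrite exchange_big pair_big /= (reindex (@enum_val _ {: rows})) /=; last first.
    by apply: onW_bij; exact: enum_val_bij.
  by apply: eq_bigr => x _; rewrite !mxE.
under eq_bigr do rewrite !mxE.
have [lt|ge] := ltnP (mdeg (bmnm (enum_val b'))) s.
  rewrite (bigD1 (enum_rank (BMultinom lt))) //= enum_rankK eqxx mulr1 big1 ?addr0 //.
  move=> a ne; case: eqP => [e|_]; last by rewrite mulr0.
  case/eqP: ne; apply: enum_val_inj; apply/val_inj; by rewrite enum_rankK /= e.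
rewrite (elimT (msize_leP _ _) rs) // big1 // => a _; case: eqP => [e|_]; last by rewrite mulr0.
by have := bmdeg (enum_val a); rewrite e ltnNge ge.
Qed.

(** The determinant of a submatrix of full rank of the table at z0.  Where it
    does not vanish, the rank of the table is at least its rank at z0, and
    graded_step applies. *)
Lemma exists_certificate s (z0 : J) :
    (forall p, exists2 r, (msz r <= s)%N & minor_ideal (jet_poly z0) (p - r)) ->
    (#|{: bmultinom N s}| < l)%N ->
  exists phi : J -> F, [/\ polyfun phi, phi z0 != 0 & forall z, phi z != 0 ->
    exists2 j, (j < l)%N & forall b, mdeg b = j ->
    exists c : rows -> F, forall b', (mdeg b' <= j)%N ->
      mcoeff b' (mpolyX F b - \sum_x c x *: (mpolyX F (bmnm x.1) * pminor (jet_poly z) x.2)) = 0].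
Proof.
move=> red sl; have rk0 := minor_table_rank red.
have [f [g nz]] := exists_full_minor (minor_table z0).
exists (fun z => \det (mxsub f g (minor_table z))); split => //.
  apply: polyfun_det => i j; apply: polyfun_ext (polyfun_minor_table (f i) (g j)) _ => z.
  by rewrite [RHS]mxE.
move=> z /minor_rank rk.
have [||j jl jP] := @graded_step _ _ _ (minor_table z) (fun b => mdeg (bmnm (enum_val b))) l.
- by move: rk rk0 sl; lia.
- by move=> b; exact: bmdeg.
exists j => // b bj.
have bl : (mdeg b < l)%N by rewrite bj.
have [|u uP] := jP (enum_rank (BMultinom bl)); first by rewrite enum_rankK.
exists (fun x => u 0 (enum_rank x)) => b' b'j.
have b'l : (mdeg b' < l)%N by apply: leq_ltn_trans jl.
have := uP (enum_rank (BMultinom b'l)); rewrite enum_rankK => /(_ b'j).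
rewrite mxE (inj_eq enum_rank_inj) bmeqP /= => e.
rewrite mcoeffB mcoeffX -e raddf_sum /= (reindex (@enum_val _ {: rows})) /=; last first.
  by apply: onW_bij; exact: enum_val_bij.
rewrite -sumrB big1 // => x _.
by rewrite mxE enum_rankK enum_valK mcoeffZ subrr.
Qed.

End Certificate.

(** * Zariski closures and codimension *)

Section ZariskiClosed.
Variables (C : numFieldType).

Section OneSpace.
Variable I : finType.
Implicit Types (Z Y : set {ffun I -> C}) (phi : {ffun I -> C} -> C).

Lemma polyfunX phi k : polyfun phi -> polyfun (fun z => phi z ^+ k).
Proof.
move=> hphi; elim: k => [|k IH]; first by apply: polyfun_ext (polyfun_const _ 1) _.
by apply: polyfun_ext (polyfunM hphi IH) _ => z; rewrite exprS.
Qed.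

Lemma algebraic_zeros (S : set ({ffun I -> C} -> C)) :
  (forall phi, S phi -> polyfun phi) -> algebraic [set z | forall phi, S phi -> phi z = 0].
Proof.
move=> SP; exists [set q | exists2 phi, S phi & forall z : {ffun I -> C},
   meval (fun k => z (enum_val k)) q = phi z].
apply/seteqP; split => z /= zS.
  by move=> q [phi Sphi qE]; rewrite qE; apply: zS.
by move=> phi Sphi; have [q qE] := SP _ Sphi; rewrite -qE; apply: zS; exists phi.
Qed.

Lemma algebraic_separate Z z : algebraic Z -> ~ Z z ->
  exists phi, [/\ polyfun phi, phi z != 0 & forall z', Z z' -> phi z' = 0].
Proof.
move=> [S ->] /= /existsNP[q /not_implyP[Sq qz]].
exists (fun z : {ffun I -> C} => meval (fun k => z (enum_val k)) q); split.
- by exists q.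
- exact/eqP.
- by move=> z'; apply.
Qed.

Lemma algebraicI Z Y : algebraic Z -> algebraic Y -> algebraic (Z `&` Y).
Proof.
move=> [S ->] [T ->]; exists (S `|` T); apply/seteqP; split=> z /=.
  by move=> [zS zT] q [/zS|/zT].
by move=> h; split=> q ?; apply: h; [left|right].
Qed.

Definition zclosure Z : set {ffun I -> C} :=
  [set z | forall phi, polyfun phi /\ (forall z', Z z' -> phi z' = 0) -> phi z = 0].

Lemma algebraic_zclosure Z : algebraic (zclosure Z).
Proof. by apply: algebraic_zeros => phi []. Qed.

Lemma sub_zclosure Z : Z `<=` zclosure Z.
Proof. by move=> z Zz phi [_]; apply. Qed.

Lemma zclosure_min Z Y : algebraic Y -> Z `<=` Y -> zclosure Z `<=` Y.
Proof.
move=> aY ZY z zZ; apply: contrapT => /(algebraic_separate aY)[phi [pphi nz phiY]].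
by case/eqP: nz; apply: zZ; split=> // z' /ZY; apply: phiY.
Qed.

Definition line (a b : {ffun I -> C}) (s : C) : {ffun I -> C} :=
  [ffun i => a i + s * (b i - a i)].

Lemma polyfun_line phi a b : polyfun phi ->
  exists p : {poly C}, forall s, p.[s] = phi (line a b s).
Proof.
move=> [q qE].
exists (mmap (@polyC C) (fun k => (a (enum_val k))%:P + 'X * (b (enum_val k) - a (enum_val k))%:P) q).
move=> s; rewrite -qE -[LHS]/(horner_eval s _) (mmap_comp (horner_eval s)).
by congr mmap; apply/funext => k /=; rewrite /horner_eval ?ffunE !hornerE.
Qed.

Lemma poly_nonroot (p : {poly C}) : p != 0 -> exists s, p.[s] != 0.
Proof.
move=> p0; apply: contrapT => h.
pose rs : seq C := [seq i%:R | i <- iota 0 (size p)].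
suff : (size rs < size p)%N by rewrite size_map size_iota ltnn.
apply: max_poly_roots => //; last first.
  by rewrite map_inj_uniq ?iota_uniq //; exact: mulrIn (oner_neq0 C).
apply/allP => _ /mapP[i _ ->]; rewrite rootE; apply: contrapT => hi.
by apply: h; exists i%:R; apply/negP.
Qed.

(** Lines are irreducible: two nonzero univariate polynomials have a common
    nonroot. *)
Lemma line_irreducible Z Y a b : algebraic Z -> algebraic Y ->
  ~ Z a -> ~ Y b -> exists s, ~ Z (line a b s) /\ ~ Y (line a b s).
Proof.
move=> aZ aY /(algebraic_separate aZ)[phi [pphi phia phiZ]].
move=> /(algebraic_separate aY)[psi [ppsi psib psiY]].
have [p pE] := polyfun_line a b pphi; have [q qE] := polyfun_line a b ppsi.
have la : line a b 0 = a by apply/ffunP => i; rewrite ffunE mul0r addr0.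
have lb : line a b 1 = b by apply/ffunP => i; rewrite ffunE mul1r addrC subrK.
have [|s] := @poly_nonroot (p * q).
  apply: mulf_neq0.
    by apply: contraNneq phia => p0; rewrite -la -pE p0 horner0.
  by apply: contraNneq psib => q0; rewrite -lb -qE q0 horner0.
rewrite hornerM mulf_eq0 negb_or pE qE => /andP[ps qs].
by exists s; split=> [/phiZ|/psiY] /eqP; apply/negP.
Qed.

End OneSpace.

Section PolynomialMaps.
Variables (I J : finType) (h : {ffun I -> C} -> {ffun J -> C}).
Hypothesis hP : forall j, polyfun (fun z => h z j).

Lemma polyfun_comp phi : polyfun phi -> polyfun (fun z => phi (h z)).
Proof.
move=> [q qE].
have F : polyfun (fun z => \sum_(a <- msupp q) mcoeff a q * \prod_k h z (enum_val k) ^+ a k).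
  apply: polyfun_sum => a; apply: polyfunM; first exact: polyfun_const.
  by apply: polyfun_prod => k; apply: polyfunX.
by apply: polyfun_ext F _ => z; rewrite -qE mevalE.
Qed.

Lemma algebraic_preimage Z : algebraic Z -> algebraic (h @^-1` Z).
Proof.
move=> aZ; rewrite (_ : h @^-1` Z = [set z | forall phi,
   (exists psi, [/\ polyfun psi, (forall z', Z z' -> psi z' = 0) & phi = psi \o h]) -> phi z = 0]).
  by apply: algebraic_zeros => _ [psi [ppsi _ ->]]; exact: polyfun_comp.
apply/seteqP; split=> z /=; first by move=> Zz _ [psi [_ psiZ ->]]; apply: psiZ.
move=> hz; apply: contrapT => /(algebraic_separate aZ)[psi [ppsi nz psiZ]].
by case/eqP: nz; apply: (hz (psi \o h)); exists psi.
Qed.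

Lemma irreducible_image Y :
  irreducible_closed Y -> irreducible_closed (zclosure (h @` Y)).
Proof.
move=> [aY [y Yy] irrY]; split; first exact: algebraic_zclosure.
  by exists (h y); apply: sub_zclosure; exists y.
move=> Z1 Z2 aZ1 aZ2 ZE.
have sub Z : algebraic Z -> Y = Y `&` h @^-1` Z -> zclosure (h @` Y) `<=` Z.
  by move=> aZ YE; apply: zclosure_min => // _ [x + <-]; rewrite YE => -[].
have [|||Y1|Y2] := irrY (Y `&` h @^-1` Z1) (Y `&` h @^-1` Z2).
- by apply: algebraicI => //; exact: algebraic_preimage.
- by apply: algebraicI => //; exact: algebraic_preimage.
- apply/seteqP; split=> [x Yx|x [[]|[]] //].
  have : zclosure (h @` Y) (h x) by apply: sub_zclosure; exists x.
  by rewrite ZE => -[?|?]; [left|right].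
- by left; apply/seteqP; split; [exact: sub|rewrite ZE; exact: subsetUl].
- by right; apply/seteqP; split; [exact: sub|rewrite ZE; exact: subsetUr].
Qed.

End PolynomialMaps.

Section CoordinateProjection.
Variables (I J : finType) (iota : I -> J).
Hypothesis iota_inj : injective iota.

Definition coord_proj (z : {ffun J -> C}) : {ffun I -> C} := [ffun i => z (iota i)].

Definition coord_ext (w : {ffun I -> C}) (z : {ffun J -> C}) : {ffun J -> C} :=
  [ffun j => if [pick i | iota i == j] is Some i then w i else z j].

Lemma coord_extK w z : coord_proj (coord_ext w z) = w.
Proof.
apply/ffunP => i; rewrite !ffunE; case: pickP => [i' /eqP/iota_inj-> //|/(_ i)].
by rewrite eqxx.
Qed.

Lemma coord_ext_id z : coord_ext (coord_proj z) z = z.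
Proof.
apply/ffunP => j; rewrite !ffunE; case: pickP => // i /eqP <-; by rewrite ffunE.
Qed.

Lemma polyfun_proj i : polyfun (fun z => coord_proj z i).
Proof. by apply: polyfun_ext (polyfun_coord C (iota i)) _ => z; rewrite ffunE. Qed.

Lemma polyfun_coord_ext z j : polyfun (fun w => coord_ext w z j).
Proof.
rewrite /coord_ext; case E: [pick i | iota i == j] => [i|].
  by apply: polyfun_ext (polyfun_coord C i) _ => w; rewrite ffunE E.
by apply: polyfun_ext (polyfun_const _ (z j)) _ => w; rewrite ffunE E.
Qed.

(** The fibres are affine spaces, hence irreducible because any two points lie
    on a line.  If the cylinder is covered by two closed sets, each fibre is
    contained in one of them, and the points of W whose fibre is contained in a
    given closed set form a closed set. *)
Lemma irreducible_cylinder W :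
  irreducible_closed W -> irreducible_closed (coord_proj @^-1` W).
Proof.
move=> [aW [w Ww] irrW]; split.
- by apply: algebraic_preimage => //; exact: polyfun_proj.
- by exists (coord_ext w [ffun _ => 0]); rewrite /= coord_extK.
move=> Z1 Z2 aZ1 aZ2 ZE.
(* The points whose fibre lies in Z, written as a set of zeros. *)
pose fib Z := [set u | forall phi, (exists2 z : {ffun J -> C}, True &
  exists psi, [/\ polyfun psi, (forall z', Z z' -> psi z' = 0) &
  phi = (fun u => psi (coord_ext u z))]) -> phi u = 0] : set {ffun I -> C}.
have fibE Z u : algebraic Z -> fib Z u <-> forall z, Z (coord_ext u z).
  move=> aZ; split=> [fu z|fu _ [z _ [psi [_ psiZ ->]]]]; last exact: psiZ.
  apply: contrapT => /(algebraic_separate aZ)[psi [ppsi nz psiZ]].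
  by case/eqP: nz; apply: (fu (fun u => psi (coord_ext u z))); exists z => //; exists psi.
have afib Z : algebraic (fib Z).
  apply: algebraic_zeros => _ [z _ [psi [ppsi _ ->]]].
  by apply: (@polyfun_comp _ _ (fun u => coord_ext u z)) => // j; exact: polyfun_coord_ext.
have sub Z : algebraic Z -> W = W `&` fib Z -> coord_proj @^-1` W `<=` Z.
  move=> aZ WE z; rewrite /= WE => -[_ /(fibE _ _ aZ)/(_ z)].
  by rewrite coord_ext_id.
have [|||W1|W2] := irrW (W `&` fib Z1) (W `&` fib Z2).
- exact: algebraicI.
- exact: algebraicI.
- apply/seteqP; split=> [u Wu|u [[]|[]] //].
  apply: contrapT => nfib.
  have [a na] : exists a, ~ Z1 (coord_ext u a).
    by apply/existsNP => h; apply: nfib; left; split=> //; apply/fibE.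
  have [b nb] : exists b, ~ Z2 (coord_ext u b).
    by apply/existsNP => h; apply: nfib; right; split=> //; apply/fibE.
  have [s [n1 n2]] := line_irreducible aZ1 aZ2 na nb.
  set z := line _ _ _ in n1 n2.
  have : (coord_proj @^-1` W) z.
    rewrite /= (_ : coord_proj z = u) //; apply/ffunP => i; rewrite !ffunE.
    case: pickP => [i' /eqP/iota_inj->|/(_ i)]; last by rewrite eqxx.
    by rewrite subrr mulr0 addr0.
  by rewrite ZE => -[].
- by left; apply/seteqP; split; [exact: sub|rewrite ZE; exact: subsetUl].
- by right; apply/seteqP; split; [exact: sub|rewrite ZE; exact: subsetUr].
Qed.

(** Below the cylinders over a chain that starts at W, the closure of the
    projection of Y, one more step is gained: Y is not the whole cylinder over
    W, since some point over W is outside Z'. *)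
Lemma codim_step Z Z' k : algebraic Z -> codim_ge Z k -> Z' `<=` coord_proj @^-1` Z ->
  (forall z, exists z', coord_proj z' = z /\ ~ Z' z') -> codim_ge Z' k.+1.
Proof.
move=> aZ codZ Z'Z ext Y irrY YZ'.
have irrW := irreducible_image polyfun_proj irrY.
set W := zclosure _ in irrW.
have WZ : W `<=` Z by apply: zclosure_min => // _ [y /YZ'/Z'Z Zy <-].
have [W_ [W0 Wirr Wlt]] := codZ W irrW WZ.
exists (fun i => if i is i'.+1 then coord_proj @^-1` W_ i' else Y); split=> //.
  by case=> [|i] // ik; apply: irreducible_cylinder; apply: Wirr.
have lift_prop (U V : set {ffun I -> C}) : U `<` V -> coord_proj @^-1` U `<` coord_proj @^-1` V.
  rewrite !properEneq => -[UV sUV]; split; last by move=> z; apply: sUV.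
  apply/eqP => UVE; case/eqP: UV; apply/seteqP; split=> // v Vv.
  have : (coord_proj @^-1` V) (coord_ext v [ffun _ => 0]) by rewrite /= coord_extK.
  by rewrite -UVE /= coord_extK.
case=> [_|i ik]; last exact/lift_prop/Wlt.
rewrite W0 properEneq; split; last by move=> y Yy; apply: sub_zclosure; exists y.
apply/eqP => YE; have [_ [w Ww] _] := irrW.
have [z' [z'w nZ']] := ext w.
by apply: nZ'; apply: YZ'; rewrite YE /= z'w.
Qed.

End CoordinateProjection.
End ZariskiClosed.

Section JetTower.
Variables (C : numFieldType) (N m n : nat).
Local Notation jet := (jet C N m n).
Local Notation germ := ('rV[C]_N -> 'M[C]_(m, n)).

Definition jet_index r : Type := (bmultinom N r.+1 * 'I_m * 'I_n)%type.

Definition widen_index r l (rl : (r <= l)%N) (k : jet_index r) : jet_index l :=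
  (BMultinom (leq_trans (bmdeg k.1.1) (rl : (r.+1 <= l.+1)%N)), k.1.2, k.2).

Lemma widen_index_inj r l (rl : (r <= l)%N) : injective (widen_index rl).
Proof. by move=> [[a i] j] [[b i'] j'] [] ab -> ->; congr (_, _, _); apply/val_inj. Qed.

Definition jet_trunc r l (rl : (r <= l)%N) : jet l -> jet r := coord_proj (widen_index rl).

Lemma jet_trunc_of r l (rl : (r <= l)%N) (F : germ) :
  jet_trunc rl (jet_of l F) = jet_of r F.
Proof. by apply/ffunP => k; rewrite !ffunE. Qed.

Lemma jet_projE r (z : jet r.+1) : jet_proj z = jet_trunc (leqnSn r) z.
Proof.
apply/ffunP => k; rewrite !ffunE; congr (z (_, _, _)); exact/val_inj.
Qed.

Lemma jet_trunc_comp r l k (rl : (r <= l)%N) (lk : (l <= k)%N) z :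
  jet_trunc rl (jet_trunc lk z) = jet_trunc (leq_trans rl lk) z.
Proof.
apply/ffunP => i; rewrite !ffunE; congr (z (_, _, _)); exact/val_inj.
Qed.

Variable bad : set germ.

Definition bad_jets r : set (jet r) := zclosure [set jet_of r F | F in bad].

Lemma bad_jets_trunc r l (rl : (r <= l)%N) z : bad_jets z -> bad_jets (jet_trunc rl z).
Proof.
rewrite /bad_jets => zb.
have := @zclosure_min _ _ _ (jet_trunc rl @^-1` bad_jets (r := r)) _ _ z zb; apply.
  apply: algebraic_preimage; first exact: polyfun_proj.
  exact: algebraic_zclosure.
move=> _ [F badF <-]; rewrite /= jet_trunc_of; apply: sub_zclosure; by exists F.
Qed.

(** Each extension step raises the codimension by one. *)
Lemma bad_germs_infinite_codim :
    (forall r, exists l (rl : (r <= l)%N), forall z : jet r, exists z' : jet l,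
       jet_trunc rl z' = z /\ ~ bad_jets z') ->
  proalgebraic_infinite_codim
    [set F | analytic_germ F /\ forall r, bad_jets (jet_of r F)].
Proof.
move=> ext; exists bad_jets; split=> //.
- by move=> r; exact: algebraic_zclosure.
- by move=> r z bz; rewrite /= jet_projE; exact: bad_jets_trunc.
move=> k; suff [r0 r0P] : exists r0, forall r, (r0 <= r)%N -> codim_ge (bad_jets (r := r)) k.
  by exists r0 => // r /=; apply: r0P.
elim: k => [|k [r0 r0P]].
  by exists 0%N => r _ Y irrY _; exists (fun _ => Y).
have [l [rl lP]] := ext r0; exists l => r lr.
apply: (codim_step (@widen_index_inj _ _ (leq_trans rl lr)) _ (r0P r0 (leqnn _))).
- exact: algebraic_zclosure.
- by move=> z; exact: bad_jets_trunc.
move=> z; have [z' [z'z nb]] := lP z.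
have inj := @widen_index_inj _ _ lr.
exists (coord_ext (widen_index lr) z' [ffun _ => 0]); split.
  by rewrite -[LHS]/(jet_trunc _ _) -jet_trunc_comp /jet_trunc coord_extK.
by move=> /(bad_jets_trunc lr); rewrite /jet_trunc coord_extK.
Qed.

End JetTower.

(** * Power series *)

Section Norms.
Variable C : numFieldType.

Lemma entry_norm_le m n (M : 'M[C]_(m, n)) i j : `|M i j| <= `|M|.
Proof.
rewrite [leRHS]/Num.norm /= mx_normE.
have : (`|M i j|%:nng <= \big[Num.max/0%:nng]_k `|M k.1 k.2|%:nng)%O.
  exact: (le_bigmax _ (fun k : 'I_m * 'I_n => `|M k.1 k.2|%:nng) (i, j)).
by rewrite -num_le.
Qed.

Lemma matrix_norm_le m n (M : 'M[C]_(m, n)) e :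
  0 <= e -> (forall i j, `|M i j| <= e) -> `|M| <= e.
Proof.
move=> e0 Me; have [->|M0] := eqVneq M 0; first by rewrite normr0.
have [|k Mk] := @mx_norm_neq0 _ _ _ M; last by rewrite [leLHS]/Num.norm /= Mk.
by apply: contra_neq M0; exact: mx_norm_eq0.
Qed.

Lemma norm_attained m n (M : 'M[C]_(m, n)) : M != 0 -> exists i j, `|M i j| = `|M|.
Proof.
move=> M0; have [|k Mk] := @mx_norm_neq0 _ _ _ M.
  by apply: contra_neq M0; exact: mx_norm_eq0.
by exists k.1, k.2; rewrite -Mk.
Qed.

Lemma exists_lower_bound (a b : C) : 0 < a -> 0 < b -> exists c, [/\ 0 < c, c <= a & c <= b].
Proof.
move=> a0 b0; have [ab|/ltW ba] := real_leP (gtr0_real a0) (gtr0_real b0).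
  by exists a.
by exists b.
Qed.

Lemma limit_dist_le (u : nat -> C) (y t B : C) d0 :
  u @ \oo --> y -> (forall d, (d0 <= d)%N -> `|u d - t| <= B) -> `|y - t| <= B.
Proof.
move=> uy uB; apply/ler_addgt0Pl => e e0.
have /cvgrPdist_lt/(_ e e0)[d1 _ d1P] := uy.
have := d1P (maxn d0 d1); rewrite /= leq_maxr => /(_ isT) /ltW ye.
have uBd := uB (maxn d0 d1) (leq_maxl _ _).
by rewrite -[y](subrK (u (maxn d0 d1))) -addrA; apply: le_trans (ler_normD _ _) (lerD ye uBd).
Qed.

End Norms.

Section MonomialBounds.
Variables (C : numFieldType) (s e : C).

(** The estimates satisfied by the values of a monomial of degree k at two points
    of norm at most s and at distance at most e. *)
Definition lip (k : nat) (u v : C) : Prop :=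
  [/\ `|u| <= s ^+ k, `|v| <= s ^+ k & `|u - v| <= k%:R * e * s ^+ k.-1].

Lemma lipM k l u v u' v' : lip k u v -> lip l u' v' -> lip (k + l) (u * u') (v * v').
Proof.
move=> [us vs uv] [us' vs' uv'].
split; [by rewrite normrM exprD ler_pM|by rewrite normrM exprD ler_pM|].
have -> : u * u' - v * v' = (u - v) * u' + v * (u' - v') by ring.
apply: le_trans (ler_normD _ _) _; rewrite !normrM natrD mulrDl mulrDl; apply: lerD.
  apply: le_trans (ler_pM _ _ uv us') _ => //.
  by case: (k) => [|k']; rewrite ?mul0r // addSn /= exprD mulrA.
apply: le_trans (ler_pM _ _ vs uv') _ => //.
by case: (l) => [|l']; rewrite ?mul0r ?mulr0 // addnS /= exprD; rewrite mulrCA.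
Qed.

Lemma lip_monomial N (x y : 'rV[C]_N) a :
  (forall i, `|x 0 i| <= s) -> (forall i, `|y 0 i| <= s) ->
  (forall i, `|x 0 i - y 0 i| <= e) ->
  lip (mdeg a) (monomial_at a x) (monomial_at a y).
Proof.
move=> xs ys xy; rewrite /monomial_at mdegE.
have l0 : lip 0 1 1 by split; rewrite ?normr1 ?expr0 // subrr normr0 !mul0r.
have : forall r : seq 'I_N,
    lip (\sum_(i <- r) a i)  (\prod_(i <- r) x 0 i ^+ a i) (\prod_(i <- r) y 0 i ^+ a i).
  elim=> [|i r IH]; first by rewrite !big_nil.
  rewrite !big_cons; apply: lipM => //; elim: (a i) => [|k IHk]; first by rewrite !expr0.
  rewrite !exprS -add1n; apply: lipM => //.
  by split; rewrite ?expr1 // expr0 mul1r mulr1.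
exact.
Qed.

End MonomialBounds.

Section PowerSeries.
Variables (C : numFieldType) (N : nat).
Implicit Types (c : multinom N -> C) (x h p : 'rV[C]_N).

Definition widen_mnm l d (ld : (l <= d)%N) (a : bmultinom N l) : bmultinom N d :=
  BMultinom (leq_trans (bmdeg a) ld).

Lemma power_sum_split c l d x : (l <= d)%N ->
  power_sum c d x = power_sum c l x +
    \sum_(a : bmultinom N d | (l <= mdeg (bmnm a))%N) c a * monomial_at a x.
Proof.
move=> ld; rewrite /power_sum (bigID (fun a : bmultinom N d => (l <= mdeg (bmnm a))%N)) addrC.
congr (_ + _); case: (posnP l) => [l0|l0].
  rewrite big1 => [|a]; last by rewrite l0.
  by rewrite big1 // => a _; have := leq_trans (bmdeg a) (eq_leq l0).
have m0 : (mdeg (@mnm0 N) < l)%N by rewrite mdeg0.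
rewrite (reindex_onto (widen_mnm ld) (fun a => insubd (BMultinom m0) (bmnm a))) /=.
  apply: eq_bigl => a; rewrite -ltnNge bmdeg /=; apply/eqP/val_inj => /=.
  by rewrite val_insubd bmdeg.
by move=> a; rewrite -ltnNge => al; apply/val_inj; rewrite /= val_insubd al.
Qed.

Lemma monomial_at0 (a : multinom N) : monomial_at a (0 : 'rV[C]_N) = (a == @mnm0 N)%:R.
Proof.
rewrite /monomial_at; case: eqVneq => [->|a0].
  by rewrite big1 // => i _; rewrite mnm0E expr0.
have [i ai] : exists i, a i != 0%N.
  apply: contrapT => h; case/eqP: a0; apply/mnmP => i; rewrite mnm0E.
  by apply/eqP; apply: contrapT => /negP hi; apply: h; exists i.
by rewrite (bigD1 i) //= mxE expr0n (negPf ai) mul0r.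
Qed.

Lemma monomial_at_const (a : multinom N) (s : C) :
  monomial_at a (const_mx s) = s ^+ mdeg a.
Proof.
rewrite /monomial_at mdegE -prodrXr; by apply: eq_bigr => i _; rewrite mxE.
Qed.

(** On the polydisc of radius rho / 2, the monomials of degree k > l have
    Lipschitz constant k s^(k-1) <= s^l (2 / rho)^(l+1) rho^k, and the sum of
    the |c a| rho^k is bounded.  Only partial sums are estimated, so nothing has
    to be known about the convergence of the differentiated series. *)
Lemma power_series_tail f p c l : has_power_series f p c ->
  exists K r : C, [/\ 0 <= K, 0 < r & forall x h (s : C), `|x| + `|h| <= s -> s <= r ->
    `|f (p + (x + h)) - f (p + x) -
      (power_sum c l.+1 (x + h) - power_sum c l.+1 x)| <= K * `|h| * s ^+ l].
Proof.
move=> [rho [rho0 [M MP] cvg]].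
have M0 : 0 <= M by have := MP 0%N; rewrite /power_sum big1 // => a; have := bmdeg a.
exists ((2 / rho) ^+ l.+1 * M), (rho / 2).
have r2 : 0 < 2 / rho by rewrite divr_gt0.
split; [by rewrite mulr_ge0 // exprn_ge0 // ltW | by rewrite divr_gt0 |].
move=> x h s xhs sr.
have s0 : 0 <= s by apply: le_trans xhs; rewrite addr_ge0.
have srho : s < rho by apply: le_lt_trans sr _; rewrite ltr_pdivrMr // ltr_pMr // ltr1n.
have xs i : `|x 0 i| <= s.
  by apply: le_trans (entry_norm_le _ _ _) _; apply: le_trans xhs; rewrite lerDl.
have xhi i : `|(x + h) 0 i| <= s.
  by apply: le_trans (entry_norm_le _ _ _) _; apply: le_trans xhs; exact: ler_normD.
have hi i : `|(x + h) 0 i - x 0 i| <= `|h|.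
  by rewrite mxE [x 0 i + _]addrC addrK; exact: entry_norm_le.
have cv (y : 'rV[C]_N) : (forall i, `|y 0 i| <= s) -> power_sum c d y @[d --> \oo] --> f (p + y).
  by move=> ys; apply: cvg => i; apply: le_lt_trans srho.
apply: (@limit_dist_le _ (fun d => power_sum c d (x + h) - power_sum c d x) _ _ _ l.+1).
  exact: cvgB (cv _ xhi) (cv _ xs).
move=> d ld; rewrite !(power_sum_split c _ ld).
have cancel_heads (a1 a2 b1 b2 : C) : a1 + b1 - (a2 + b2) - (a1 - a2) = b1 - b2 by ring.
rewrite cancel_heads -sumrB.
apply: le_trans (ler_norm_sum _ _ _) _.
apply: (@le_trans _ _ (\sum_(a : bmultinom N d | (l < mdeg (bmnm a))%N)
   (2 / rho) ^+ l.+1 * `|h| * s ^+ l * (`|c a| * rho ^+ mdeg (bmnm a)))).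
  apply: ler_sum => a la; rewrite -mulrBr normrM [leRHS]mulrCA; apply: ler_pM => //.
  have [_ _] := lip_monomial (bmnm a) xhi xs hi.
  move/le_trans; apply.
  set k := mdeg (bmnm a) in la *.
  have kE : k = ((k - l.+1) + l.+1)%N by rewrite subnK.
  have -> : k.-1 = ((k - l.+1) + l)%N by rewrite {1}kE addnS.
  rewrite exprD (_ : _ * _ = (`|h| * s ^+ l) * (k%:R * s ^+ (k - l.+1))); last first.
    by move: (s ^+ _) (s ^+ l) => A B; ring.
  rewrite [leRHS](_ : _ = (`|h| * s ^+ l) * ((2 / rho) ^+ l.+1 * rho ^+ k)); last first.
    by move: (s ^+ _) (rho ^+ k) ((2 / rho) ^+ _) => A B D; ring.
  apply: ler_wpM2l; first by rewrite mulr_ge0 ?exprn_ge0.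
  apply: (@le_trans _ _ (2 ^+ k * (rho / 2) ^+ (k - l.+1))).
    apply: ler_pM => //; rewrite ?exprn_ge0 //.
      by rewrite -natrX ler_nat ltnW // ltn_expl.
    by apply: lerXn2r; rewrite // nnegrE ?divr_ge0 // ltW.
  rewrite {1 3}kE !exprD !expr_div_n le_eqVlt; apply/orP; left; apply/eqP.
  by field; rewrite !expf_neq0 // gt_eqF.
rewrite -mulr_sumr [leRHS](_ : _ = (2 / rho) ^+ l.+1 * `|h| * s ^+ l * M); last first.
  by move: (s ^+ _) ((2 / rho) ^+ _) => A B; ring.
apply: ler_wpM2l; first by rewrite !mulr_ge0 ?exprn_ge0 // ltW.
apply: le_trans (MP d); rewrite /power_sum [leRHS](bigID (fun a : bmultinom N d => (l < mdeg (bmnm a))%N)) /=.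
under eq_bigr do rewrite -monomial_at_const.
rewrite lerDl sumr_ge0 // => a _; rewrite mulr_ge0 //.
by rewrite monomial_at_const exprn_ge0 // ltW.
Qed.

End PowerSeries.

Section FirstOrder.
Variables (C : numFieldType) (N : nat).
Implicit Types (c : multinom N -> C) (x h p : 'rV[C]_N) (q : mpoly N C).

Definition pev x q : C := meval (fun i => x 0 i) q.

Definition taylor_poly c l : mpoly N C :=
  \sum_(a : bmultinom N l.+1) c a *: mpolyX C (bmnm a).

Lemma pev_taylor_poly c l x : pev x (taylor_poly c l) = power_sum c l.+1 x.
Proof.
by rewrite /pev raddf_sum; apply: eq_bigr => a _; rewrite /= mevalZ mevalX.
Qed.

Lemma power_series_center f p c l : has_power_series f p c ->
  f p = power_sum c l.+1 0.
Proof.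
move=> [rho [rho0 _ cvg]]; apply/eqP; rewrite -subr_eq0 -normr_le0.
apply: (@limit_dist_le _ (fun d => power_sum c d 0) _ _ _ l.+1).
  by rewrite -[p]addr0; apply: cvg => i; rewrite mxE normr0.
move=> d ld; rewrite (power_sum_split _ _ ld) addrC addKr big1 ?normr0 // => a la.
rewrite monomial_at0; case: eqVneq => [a0|]; last by rewrite mulr0.
by rewrite a0 mdeg0 in la.
Qed.

Lemma taylor_remainder f p c l : has_power_series f p c ->
  exists K r : C, [/\ 0 <= K, 0 < r & forall x, `|x| <= r ->
    `|f (p + x) - pev x (taylor_poly c l)| <= K * `|x| ^+ l.+1].
Proof.
move=> fc; have [K [r [K0 r0 Kr]]] := power_series_tail l fc.
exists K, r; split=> // x xr; have := Kr 0 x `|x|.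
rewrite normr0 add0r addr0 lexx add0r => /(_ isT xr).
by rewrite (power_series_center l fc) opprB addrA subrK pev_taylor_poly exprS mulrA.
Qed.

Lemma first_order_expansion f p c : has_power_series f p c ->
  exists (g : 'I_N -> C) (K r : C), [/\ 0 <= K, 0 < r & forall h, `|h| <= r ->
    `|f (p + h) - f p - \sum_i h 0 i * g i| <= K * `|h| ^+ 2].
Proof.
move=> fc; have [K [r [K0 r0 Kr]]] := power_series_tail 1 fc.
exists (fun i => \sum_(a : bmultinom N 2) c a * (bmnm a == mnm1 i)%:R), K, r.
split=> // h hr; have := Kr 0 h `|h|.
rewrite normr0 add0r addr0 lexx add0r => /(_ isT hr).
rewrite expr1 -mulrA -expr2; congr (_ <= _); congr (`|_ - _|).
rewrite /power_sum -sumrB; under [RHS]eq_bigr do rewrite mulr_sumr.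
rewrite exchange_big /=; apply: eq_bigr => a _.
rewrite -mulrBr monomial_at0; under [RHS]eq_bigr do rewrite mulrCA.
rewrite -mulr_sumr; congr (_ * _).
have [a0|a0] := eqVneq (bmnm a) (@mnm0 N).
  rewrite big1 => [|i _]; last by rewrite a0 eq_sym mnm1_eq0 mulr0.
  rewrite a0 /monomial_at big1 ?subrr // => i _; by rewrite mnm0E expr0.
have : mdeg (bmnm a) = 1%N.
  by apply/eqP; rewrite eqn_leq -ltnS bmdeg /= lt0n mdeg_eq0.
move/eqP/mdeg1P => [i /eqP ai].
rewrite subr0 ai (bigD1 i) //= eqxx mulr1 big1 ?addr0; last first.
  by move=> j ji; rewrite eq_mnm1 eq_sym (negPf ji) mulr0.
rewrite /monomial_at (bigD1 i) //= mnm1E eqxx expr1 big1 ?mulr1 // => j ji.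
by rewrite mnm1E eq_sym (negPf ji) expr0.
Qed.

Lemma poly_line_expansion q x j : exists u : {poly C}, forall t,
  pev (x + t *: delta_mx 0 j) q = pev x q + t * pev x (mderiv j q) + t ^+ 2 * u.[t].
Proof.
pose E (f : mpoly N C) := exists u : {poly C}, forall t,
  pev (x + t *: delta_mx 0 j) f = pev x f + t * pev x (mderiv j f) + t ^+ 2 * u.[t].
have EC (c : C) : E (mpolyC N c).
  by exists 0 => t; rewrite mderivC /pev meval0 !mevalC horner0; ring.
have EM f g : E f -> E g -> E (f * g).
  move=> [u uE] [v vE].
  exists ((pev x f)%:P * v + (pev x g)%:P * u + (pev x (mderiv j f) * pev x (mderiv j g))%:P
    + 'X * ((pev x (mderiv j f))%:P * v + (pev x (mderiv j g))%:P * u) + 'X^2 * (u * v)) => t.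
  rewrite /pev in uE vE *; rewrite mevalM uE vE mderivM mevalD !mevalM !(hornerD, hornerM, hornerC, hornerX, hornerXn); ring.
have EX i : E (mpolyX C (mnm1 i)).
  exists 0 => t; rewrite /pev !mevalXU !mxE horner0 mderivX mnm1E mevalZ eqxx /=.
  case: (eqVneq i j) => [->|ne]; last by rewrite !(mulr0n, mul0r, mulr0, addr0).
  rewrite (_ : mnm_sub _ _ = @mnm0 N) ?mpolyX0 ?meval1; first by ring.
  by apply/mnmP => k; rewrite mnmBE mnm0E subnn.
elim/mpolyind: q => [|c m q _ _ [u uE]]; first by rewrite -mpolyC0; exact: EC.
have [v vE] : E (mpolyX C m).
  rewrite mpolyXE_id; elim/big_ind: _ => [|f g|i _]; [by rewrite -mpolyC1|exact: EM|].
  elim: (m i) => [|k IH]; first by rewrite expr0 -mpolyC1.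
  by rewrite exprS; apply: EM.
exists (c%:P * v + u) => t; rewrite /pev in uE vE *.
rewrite !(mderivD, mderivZ, mevalD, mevalZ) uE vE !(hornerD, hornerM, hornerC); ring.
Qed.

Lemma poly_first_order q x j : exists2 K : C, 0 <= K & forall t, `|t| <= 1 ->
  `|pev (x + t *: delta_mx 0 j) q - pev x q - t * pev x (mderiv j q)| <= K * `|t| ^+ 2.
Proof.
have [u uE] := poly_line_expansion q x j.
exists (\sum_(i < size u) `|u`_i|); first by rewrite sumr_ge0.
move=> t t1; rewrite uE (_ : _ - _ - _ = t ^+ 2 * u.[t]); last by ring.
rewrite normrM normrX mulrC ler_wpM2r ?exprn_ge0 // horner_coef.
apply: le_trans (ler_norm_sum _ _ _) _; apply: ler_sum => i _.
by rewrite normrM normrX ler_piMr // exprn_ile1.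
Qed.

Lemma finite_lower_bound (I : finType) (r : I -> C) :
  (forall i, 0 < r i) -> exists2 e, 0 < e & forall i, e <= r i.
Proof.
move=> r0; suff [e e0 eP] : exists2 e, 0 < e & forall i, i \in enum I -> e <= r i.
  by exists e => // i; apply: eP; rewrite mem_enum.
elim: (enum I) => [|i s [e e0 es]]; first by exists 1.
have [d [d0 de di]] := exists_lower_bound e0 (r0 i); exists d => // k.
by rewrite inE => /orP[/eqP->//|/es]; exact: le_trans.
Qed.

End FirstOrder.

Section Differential.
Variables (C : numFieldType) (N m n : nat).
Implicit Types (F : 'rV[C]_N -> 'M[C]_(m, n)) (x h : 'rV[C]_N).

(** The differential is read off from the power series of the entries at x. *)
Lemma analytic_differential F x : analytic_at F x ->
  [/\ forall h, 'd F x h = \sum_l h 0 l *: 'd F x (delta_mx 0 l) &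
  exists K r : C, [/\ 0 <= K, 0 < r & forall h, `|h| <= r -> forall i j,
    `|F (x + h) i j - F x i j - 'd F x h i j| <= K * `|h| ^+ 2]].
Proof.
move=> Fx.
have /choice[g0 g0P] : forall k : 'I_m * 'I_n, exists gKr : ('I_N -> C) * C * C,
    [/\ 0 <= gKr.1.2, 0 < gKr.2 & forall h, `|h| <= gKr.2 ->
    `|F (x + h) k.1 k.2 - F x k.1 k.2 - \sum_i h 0 i * gKr.1.1 i| <= gKr.1.2 * `|h| ^+ 2].
  move=> k; have [c cP] := Fx k.1 k.2.
  by have [g [K [r P]]] := first_order_expansion cP; exists (g, K, r).
pose D l : 'M[C]_(m, n) := \matrix_(i, j) (g0 (i, j)).1.1 l.
pose G : 'M[C]_(N, m * n) := \matrix_l mxvec (D l).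
pose df : {linear 'rV[C]_N -> 'M[C]_(m, n)} := vec_mx \o mulmxr G.
have dfE h : df h = \sum_l h 0 l *: D l.
  rewrite /df /= mulmx_sum_row raddf_sum; apply: eq_bigr => l _.
  by rewrite /= linearZ /= rowK mxvecK.
pose K := \sum_k (g0 k).1.2.
have K0 : 0 <= K by apply: sumr_ge0 => k _; have [] := g0P k.
have [|r r0 rP] := @finite_lower_bound _ _ (fun k => (g0 k).2); first by move=> k; have [] := g0P k.
have est h : `|h| <= r -> forall i j, `|F (x + h) i j - F x i j - df h i j| <= K * `|h| ^+ 2.
  move=> hr i j; have [Kij rij /(_ h (le_trans hr (rP (i, j))))] := g0P (i, j).
  rewrite dfE summxE; under [X in _ -> `|_ - X| <= _]eq_bigr do rewrite !mxE.
  move=> e; apply: le_trans e _; apply: ler_wpM2r; first by rewrite exprn_ge0.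
  rewrite /K (bigD1 (i, j)) //= lerDl sumr_ge0 // => k _; by have [] := g0P k.
have dcont : continuous df.
  apply: bounded_linear_continuous; apply/linear_boundedP.
  pose S := \sum_l \sum_i \sum_j `|D l i j|.
  have S0 : 0 <= S by do 3!apply: sumr_ge0 => ? _.
  near=> R => h; apply: (@le_trans _ _ (S * `|h|)); last first.
    by apply: ler_wpM2r => //; near: R; apply: nbhs_pinfty_ge; exact: ger0_real.
  apply: matrix_norm_le => [|i j]; first by rewrite mulr_ge0.
  rewrite dfE summxE; apply: le_trans (ler_norm_sum _ _ _) _; rewrite mulr_suml.
  apply: ler_sum => l _; rewrite mxE normrM mulrC.
  apply: ler_pM => //; last exact: entry_norm_le.
  rewrite (bigD1 i) //= (bigD1 j) //= -addrA lerDl addr_ge0 ?sumr_ge0 //.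
  by move=> k _; rewrite sumr_ge0.
have dE : 'd F x = df :> ('rV[C]_N -> 'M[C]_(m, n)).
  apply: diff_unique => //; apply/eqaddoP => e e0; rewrite /=.
  suff near0 : \forall h \near (0 : 'rV[C]_N), `|F (x + h) - F x - df h| <= e * `|h|.
    apply: filterS near0 => h; rewrite !fctE /= [h + x]addrC opprD addrA; exact.
  have [d [d0 dr de]] := exists_lower_bound r0 (divr_gt0 e0 (ltr_wpDl K0 ltr01)).
  apply/nbhs_norm0P; exists d => //= h /ltW hd.
  have hr := le_trans hd dr.
  apply: matrix_norm_le => [|i j]; first by rewrite mulr_ge0 // ltW.
  rewrite [X in `|X|](_ : _ = F (x + h) i j - F x i j - df h i j); last by rewrite !mxE.
  apply: le_trans (est h hr i j) _.
  rewrite expr2 mulrA; apply: ler_wpM2r => //.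
  apply: (@le_trans _ _ ((K + 1) * d)); last first.
    by rewrite mulrC -ler_pdivlMr // ltr_wpDl.
  by apply: ler_pM => //; rewrite lerDl.
split; last by exists K, r; split=> // h hr i j; rewrite dE; exact: est.
move=> h; rewrite dE dfE; apply: eq_bigr => l _; congr (_ *: _).
rewrite dfE (bigD1 l) //= big1 ?addr0 => [|k kl]; first by rewrite mxE !eqxx scale1r.
by rewrite mxE (negPf kl) andbF scale0r.
Unshelve. all: by end_near. Qed.

Lemma jet_polyE l F i j :
  jet_poly (jet_of l F) i j = taylor_poly (taylor (fun x => F x i j) 0) l.
Proof. by rewrite mxE; apply: eq_bigr => a _; rewrite ffunE. Qed.

Lemma taylor_series F i j : analytic_at F 0 ->
  has_power_series (fun x => F x i j) 0 (taylor (fun x => F x i j) 0).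
Proof.
move=> F0; have [c cP] := F0 i j.
exact: (@getPex _ [set c | has_power_series (fun x => F x i j) 0 c] (ex_intro _ c cP)).
Qed.

(** The difference of F and its Taylor polynomial at 0 has Lipschitz constant
    O(|x|^l) near x, which bounds its difference quotients at x, hence its
    partial derivatives there. *)
Lemma differential_near_jet l F i j : analytic_at F 0 ->
  exists K r : C, [/\ 0 <= K, 0 < r & forall x, 0 < `|x| <= r -> analytic_at F x ->
   forall k, `|'d F x (delta_mx 0 k) i j - pev x (mderiv k (jet_poly (jet_of l F) i j))|
     <= K * `|x| ^+ l].
Proof.
move=> F0; rewrite jet_polyE; set T := taylor_poly _ _.
have [K0 [r0 [K00 r00 Kr]]] := power_series_tail l (taylor_series i j F0).
exists (K0 * 2 ^+ l), (r0 / 2); split=> [||x /andP[x0 xr] Fx k].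
- by rewrite mulr_ge0 // exprn_ge0.
- by rewrite divr_gt0.
have [dlin [K1 [r1 [K10 r10 K1r]]]] := analytic_differential Fx.
have [K2 K20 K2r] := poly_first_order T x k.
apply/ler_addgt0Pr => e e0.
have K120 : 0 < K1 + K2 + 1 by rewrite ltr_wpDl // addr_ge0.
have [t1 [t10 t1r t1x]] := exists_lower_bound r10 x0.
have [t2 [t20 t21 t2e]] := exists_lower_bound (ltr01 : 0 < 1 :> C) (divr_gt0 e0 K120).
(* The step t of the difference quotients: small enough for the second order
   terms, with constants K1 and K2, to contribute at most e. *)
have [t [t0 tt1 tt2]] := exists_lower_bound t10 t20.
pose h : 'rV[C]_N := t *: delta_mx 0 k.
have tn : `|t| = t by rewrite gtr0_norm.
have hn : `|h| <= t.
  apply: matrix_norm_le => [|a b]; first exact: ltW.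
  by rewrite !mxE normrM tn; case: (_ && _); rewrite ?normr1 ?mulr1 ?normr0 ?mulr0 // ltW.
have tx := le_trans tt1 t1x.
have dh : 'd F x h i j = t * 'd F x (delta_mx 0 k) i j.
  rewrite dlin (bigD1 k) //= big1 ?addr0 => [|l' l'k].
    by rewrite !mxE !eqxx mulr1.
  by rewrite !mxE (negPf l'k) andbF mulr0 scale0r.
have e1 := K1r h (le_trans hn (le_trans tt1 t1r)) i j.
have e2 := K2r t; rewrite tn in e2; have {}e2 := e2 (le_trans tt2 t21).
have e3 : `|F (x + h) i j - F x i j - (pev (x + h) T - pev x T)| <= K0 * `|h| * (2 * `|x|) ^+ l.
  rewrite !pev_taylor_poly; have := Kr x h (2 * `|x|); rewrite !add0r; apply.
    by rewrite mulr2n mulrDl mul1r lerD2l (le_trans hn).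
  by rewrite mulrC -ler_pdivlMr.
rewrite dh in e1.
set A := 'd F x _ i j in e1 *; set B := pev x (mderiv k T) in e2 *.
rewrite -/h in e2.
have e4 : `|t * (A - B)| <= K0 * t * (2 * `|x|) ^+ l + K1 * t ^+ 2 + K2 * t ^+ 2.
  have -> : t * (A - B) = (F (x + h) i j - F x i j - (pev (x + h) T - pev x T)) -
     (F (x + h) i j - F x i j - t * A) + (pev (x + h) T - pev x T - t * B) by ring.
  apply: le_trans (ler_normD _ _) _; apply: lerD => //.
  apply: le_trans (ler_normB _ _) _; apply: lerD.
    apply: le_trans e3 _; apply: ler_wpM2r; first by rewrite exprn_ge0 // mulr_ge0.
    exact: ler_wpM2l.
  apply: le_trans e1 _; apply: ler_wpM2l => //; by apply: lerXn2r => //; rewrite nnegrE // ltW.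
move: e4; rewrite normrM tn.
have -> : K0 * t * (2 * `|x|) ^+ l + K1 * t ^+ 2 + K2 * t ^+ 2 =
  t * (K0 * 2 ^+ l * `|x| ^+ l + (K1 + K2) * t) by rewrite exprMn; ring.
rewrite ler_pM2l // => /le_trans; apply; rewrite lerD2l.
apply: (@le_trans _ _ ((K1 + K2 + 1) * t)).
  by rewrite ler_pM2r // lerDl.
by rewrite mulrC -ler_pdivlMr //; exact: le_trans t2e.
Qed.

End Differential.

(** * Minors of an analytic germ near the origin *)

Section Approximation.
Variables (C : numFieldType) (N l : nat).
Implicit Types (u v : 'rV[C]_N -> C) (x : 'rV[C]_N).

(** The boundedness of u and v makes this relation stable under products, hence
    under determinants. *)
Definition approx u v : Prop := exists2 K : C, 0 <= K &
  \forall x \near (0 : 'rV[C]_N)^', [/\ `|u x| <= K, `|v x| <= K & `|u x - v x| <= K * `|x| ^+ l].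

Lemma approx_const c : approx (fun _ => c) (fun _ => c).
Proof.
exists `|c| => //; apply: filterE => x; split=> //.
by rewrite subrr normr0 mulr_ge0 ?exprn_ge0.
Qed.

Lemma approxD u v u' v' : approx u v -> approx u' v' ->
  approx (fun x => u x + u' x) (fun x => v x + v' x).
Proof.
move=> [K K0 nK] [K' K'0 nK']; exists (K + K'); first exact: addr_ge0.
apply: filterS2 nK nK' => x [a1 a2 a3] [b1 b2 b3].
split; [exact: le_trans (ler_normD _ _) (lerD _ _) | exact: le_trans (ler_normD _ _) (lerD _ _) |].
rewrite opprD addrACA mulrDl; exact: le_trans (ler_normD _ _) (lerD _ _).
Qed.

Lemma approxM u v u' v' : approx u v -> approx u' v' ->
  approx (fun x => u x * u' x) (fun x => v x * v' x).
Proof.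
move=> [K K0 nK] [K' K'0 nK']; exists (K * K' + K * K').
  by rewrite addr_ge0 ?mulr_ge0.
apply: filterS2 nK nK' => x [a1 a2 a3] [b1 b2 b3].
have KK : 0 <= K * K' by rewrite mulr_ge0.
split.
- by rewrite normrM; apply: le_trans (ler_pM _ _ a1 b1) _; rewrite ?lerDl.
- by rewrite normrM; apply: le_trans (ler_pM _ _ a2 b2) _; rewrite ?lerDl.
have -> : u x * u' x - v x * v' x = (u x - v x) * u' x + v x * (u' x - v' x) by ring.
apply: le_trans (ler_normD _ _) _; rewrite !normrM mulrDl; apply: lerD.
  by apply: le_trans (ler_pM _ _ a3 b1) _ => //; rewrite mulrAC.
by apply: le_trans (ler_pM _ _ a2 b3) _ => //; rewrite mulrA.
Qed.

Lemma approx_ext u v u' v' : approx u v -> u =1 u' -> v =1 v' -> approx u' v'.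
Proof. by move=> uv /funext <- /funext <-. Qed.

Lemma approx_sum (J : Type) (r : seq J) (u v : J -> 'rV[C]_N -> C) :
  (forall j, approx (u j) (v j)) ->
  approx (fun x => \sum_(j <- r) u j x) (fun x => \sum_(j <- r) v j x).
Proof.
move=> uv; elim: r => [|j r IH].
  by apply: approx_ext (approx_const 0) _ _ => x; rewrite big_nil.
by apply: approx_ext (approxD (uv j) IH) _ _ => x; rewrite big_cons.
Qed.

Lemma approx_prod (J : Type) (r : seq J) (u v : J -> 'rV[C]_N -> C) :
  (forall j, approx (u j) (v j)) ->
  approx (fun x => \prod_(j <- r) u j x) (fun x => \prod_(j <- r) v j x).
Proof.
move=> uv; elim: r => [|j r IH].
  by apply: approx_ext (approx_const 1) _ _ => x; rewrite big_nil.
by apply: approx_ext (approxM (uv j) IH) _ _ => x; rewrite big_cons.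
Qed.

Lemma approx_tminor m n (B B' : 'rV[C]_N -> 'M[C]_(m, n))
    (D D' : 'rV[C]_N -> 'I_N -> 'M[C]_(m, n)) f :
  (forall i j, approx (fun x => B x i j) (fun x => B' x i j)) ->
  (forall k i j, approx (fun x => D x k i j) (fun x => D' x k i j)) ->
  approx (fun x => tminor (B x) (D x) f) (fun x => tminor (B' x) (D' x) f).
Proof.
move=> BB DD.
have gen k i j : approx (fun x => tgen (B x) (D x) k i j) (fun x => tgen (B' x) (D' x) k i j).
  case: k => [[k|[b b']]|[b b']] /=; first exact: DD.
  - have h : approx (fun x => \sum_a delta_mx b b' i a * B x a j)
                    (fun x => \sum_a delta_mx b b' i a * B' x a j).
      by apply: approx_sum => a; apply: approxM => //; exact: approx_const.
    by apply: approx_ext h _ _ => x; rewrite [RHS]mxE.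
  - have h : approx (fun x => \sum_a B x i a * delta_mx b b' a j)
                    (fun x => \sum_a B' x i a * delta_mx b b' a j).
      by apply: approx_sum => a; apply: approxM => //; exact: approx_const.
    by apply: approx_ext h _ _ => x; rewrite [RHS]mxE.
apply: approx_sum => s; apply: approxM; first exact: approx_const.
apply: approx_prod => a.
case/mxvec_indexP: (perm.fun_of_perm s a) => i j.
by apply: approx_ext (gen (f a) i j) _ _ => x; rewrite mxE mxvecE.
Qed.

Lemma pev_bound (q : mpoly N C) k : (forall a, (mdeg a < k)%N -> mcoeff a q = 0) ->
  exists2 B : C, 0 <= B & forall x, `|x| <= 1 -> `|pev x q| <= B * `|x| ^+ k.
Proof.
move=> q0; exists (\sum_(a <- msupp q) `|mcoeff a q|); first by rewrite sumr_ge0.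
move=> x x1; rewrite /pev mevalE mulr_suml.
apply: le_trans (ler_norm_sum _ _ _) _; rewrite big_seq [leRHS]big_seq.
apply: ler_sum => a aq; rewrite normrM; apply: ler_wpM2l => //.
have ka : (k <= mdeg a)%N.
  by rewrite leqNgt; apply: contraL aq => /q0/eqP; rewrite mcoeff_eq0.
have xx i : `|x 0 i| <= `|x| by exact: entry_norm_le.
have [+ _ _] := @lip_monomial C `|x| 0 N x x a xx xx (fun i => ltac:(by rewrite subrr normr0)).
by move=> /le_trans; apply; apply: ler_wiXn2l.
Qed.

End Approximation.

Section FiniteColength.
Variables (C : numFieldType) (N m n : nat).
Implicit Types (F : 'rV[C]_N -> 'M[C]_(m, n)) (x : 'rV[C]_N).

Definition good_germ F : Prop := \forall x \near (0 : 'rV[C]_N)^',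
  exists f, tminor (F x) (fun k => 'd F x (delta_mx 0 k)) f != 0.

Lemma dnbhs0_norm (r : C) : 0 < r ->
  \forall x \near (0 : 'rV[C]_N)^', 0 < `|x| <= r.
Proof.
move=> r0; near=> x; rewrite normr_gt0; apply/andP; split.
  by near: x; exact: nbhs_dnbhs_neq.
by near: x; exact: dnbhs0_le.
Unshelve. all: by end_near. Qed.

Lemma approx_minors l F f : analytic_germ F ->
  approx l (fun x => tminor (F x) (fun k => 'd F x (delta_mx 0 k)) f)
    (fun x => pev x (pminor (jet_poly (jet_of l F)) f)).
Proof.
move=> anF; have F0 : analytic_at F 0 := nbhs_singleton anF.
set T := jet_poly _.
have bound (q : mpoly N C) : exists2 B : C, 0 <= B & forall x, `|x| <= 1 -> `|pev x q| <= B.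
  have [//|B B0 Bq] := @pev_bound C N q 0; exists B => // x /Bq.
  by rewrite expr0 mulr1.
have aF i j : approx l (fun x => F x i j) (fun x => pev x (T i j)).
  have [K [r [K0 r0 Kr]]] := taylor_remainder l (taylor_series i j F0).
  have [B B0 BT] := bound (T i j).
  exists (K + B); first exact: addr_ge0.
  near=> x.
  have /andP[_ x1] : 0 < `|x| <= 1 by near: x; exact: (dnbhs0_norm ltr01).
  have /andP[_ xr] : 0 < `|x| <= r by near: x; exact: (dnbhs0_norm r0).
  have := Kr x xr; rewrite add0r -jet_polyE -/T => d.
  have dl : `|F x i j - pev x (T i j)| <= K * `|x| ^+ l.
    by apply: le_trans d _; rewrite ler_wpM2l // exprS ler_piMl // exprn_ge0.
  have dK : `|F x i j - pev x (T i j)| <= K.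
    by apply: le_trans dl _; rewrite ler_piMr // exprn_ile1.
  split.
  - rewrite -[F x i j](subrK (pev x (T i j))); apply: le_trans (ler_normD _ _) _.
    by apply: lerD => //; exact: BT.
  - by apply: le_trans (BT x x1) _; rewrite lerDr.
  - by apply: le_trans dl _; rewrite ler_wpM2r ?exprn_ge0 // lerDl.
have aD k i j : approx l (fun x => 'd F x (delta_mx 0 k) i j)
    (fun x => pev x (mderiv k (T i j))).
  have [K [r [K0 r0 Kr]]] := differential_near_jet l i j F0.
  have [B B0 BT] := bound (mderiv k (T i j)).
  exists (K + B); first exact: addr_ge0.
  near=> x.
  have /andP[_ x1] : 0 < `|x| <= 1 by near: x; exact: (dnbhs0_norm ltr01).
  have xr : 0 < `|x| <= r by near: x; exact: (dnbhs0_norm r0).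
  have Fx : analytic_at F x by near: x; exact: nbhs_dnbhs.
  have dl := Kr x xr Fx k.
  have dK : `|'d F x (delta_mx 0 k) i j - pev x (mderiv k (T i j))| <= K.
    by apply: le_trans dl _; rewrite ler_piMr // exprn_ile1.
  split.
  - rewrite -['d F x _ i j](subrK (pev x (mderiv k (T i j)))).
    by apply: le_trans (ler_normD _ _) _; apply: lerD => //; exact: BT.
  - by apply: le_trans (BT x x1) _; rewrite lerDr.
  - by apply: le_trans dl _; rewrite ler_wpM2r ?exprn_ge0 // lerDl.
have h := @approx_tminor C N l m n F (fun x => map_mx (pev x) T)
   (fun x k => 'd F x (delta_mx 0 k)) (fun x k => map_mx (pev x) (map_mx (mderiv k) T)) f.
apply: approx_ext (h _ _) _ _ => //.
- by move=> i j; apply: approx_ext (aF i j) _ _ => // x; rewrite [RHS]mxE.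
- move=> k i j; apply: approx_ext (aD k i j) _ _ => // x.
  by rewrite [RHS]mxE [X in _ = pev _ X]mxE.
- by move=> x; rewrite -(map_tminor (meval (fun i => x 0 i))).
Unshelve. all: by end_near. Qed.

(** If all minors of F vanish at x, those of its jet are O(|x|^l) there.  At a
    coordinate with |x_i| = |x|, the expression of x_i^j through the minors
    gives |x|^j <= M |x|^(j+1), which is impossible for small x. *)
Lemma finite_colength_good l j F : analytic_germ F -> (j < l)%N ->
    (forall b, mdeg b = j -> exists c : bmultinom N l * {ffun 'I_(m * n) -> tindex N m n} -> C,
      forall b', (mdeg b' <= j)%N -> mcoeff b' (mpolyX C b -
        \sum_x c x *: (mpolyX C (bmnm x.1) * pminor (jet_poly (jet_of l F)) x.2)) = 0) ->
  good_germ F.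
Proof.
move=> anF jl comb; set T := jet_poly _ in comb.
have /choice[K_ KP] : forall f, exists K : C, 0 <= K /\
    \forall x \near (0 : 'rV[C]_N)^',
      `|tminor (F x) (fun k => 'd F x (delta_mx 0 k)) f - pev x (pminor T f)| <= K * `|x| ^+ l.
  move=> f; have [K K0 nK] := approx_minors l f anF; exists K; split=> //.
  by apply: filterS nK => x [].
have /choice[c cP] : forall i : 'I_N, exists c : bmultinom N l * {ffun 'I_(m * n) -> tindex N m n} -> C,
      forall b', (mdeg b' <= j)%N -> mcoeff b' (mpolyX C (mnm_muln (mnm1 i) j) -
        \sum_x c x *: (mpolyX C (bmnm x.1) * pminor T x.2)) = 0.
  by move=> i; apply: comb; rewrite mdegMn mdeg1 mul1n.
have /choice[B_ BP] : forall i : 'I_N, exists B : C, 0 <= B /\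
   forall x, `|x| <= 1 -> `|pev x (mpolyX C (mnm_muln (mnm1 i) j) -
        \sum_y c i y *: (mpolyX C (bmnm y.1) * pminor T y.2))| <= B * `|x| ^+ j.+1.
  by move=> i; have [B B0 PB] := pev_bound (k := j.+1) (cP i); exists B.
(* M bounds the constants for all coordinates i at once. *)
pose M := \sum_i (B_ i + \sum_y `|c i y| * K_ y.2).
have term0 i : 0 <= B_ i + \sum_y `|c i y| * K_ y.2.
  by rewrite addr_ge0 ?(BP i).1 ?sumr_ge0 // => y _; rewrite mulr_ge0 ?(KP y.2).1.
have M0 : 0 <= M by rewrite sumr_ge0.
have M1 : 0 < M + 1 by rewrite ltr_wpDl.
have nK : \forall x \near (0 : 'rV[C]_N)^', forall f,
    `|tminor (F x) (fun k => 'd F x (delta_mx 0 k)) f - pev x (pminor T f)| <= K_ f * `|x| ^+ l.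
  by apply: filter_forall => f; exact: (KP f).2.
apply: filterS3 nK (dnbhs0_norm ltr01) (dnbhs0_norm (divr_gt0 ltr01 (addr_gt0 M1 ltr01))).
move=> x xK /andP[x0 x1] /andP[_ xM]; apply: contrapT => /forallNP allz.
have mz f : `|pev x (pminor T f)| <= K_ f * `|x| ^+ l.
  have /negP := allz f; rewrite negbK => /eqP z.
  by have := xK f; rewrite z sub0r normrN.
have [i0 [i xi]] : exists i0 i, `|x i0 i| = `|x|.
  by apply: norm_attained; rewrite -normr_gt0.
rewrite (ord1 i0) in xi.
have Xi : pev x (mpolyX C (mnm_muln (mnm1 i) j)) = x 0 i ^+ j.
  by rewrite /pev -mpolyXn rmorphXn /= mevalXU.
have Xle a : `|pev x (mpolyX C a)| <= 1.
  rewrite /pev mevalX normr_prod; apply: prodr_ile1 => k _.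
  by rewrite normr_ge0 normrX exprn_ile1 // (le_trans (entry_norm_le _ _ _)).
have sumle : `|pev x (\sum_y c i y *: (mpolyX C (bmnm y.1) * pminor T y.2))|
    <= (\sum_y `|c i y| * K_ y.2) * `|x| ^+ j.+1.
  rewrite /pev raddf_sum mulr_suml; apply: le_trans (ler_norm_sum _ _ _) _.
  apply: ler_sum => y _; rewrite /= mevalZ mevalM !normrM -mulrA.
  apply: ler_wpM2l => //; apply: le_trans (ler_pM _ _ (Xle (bmnm y.1)) (mz y.2)) _ => //.
  rewrite mul1r; apply: ler_wpM2l; first exact: (KP y.2).1.
  by apply: ler_wiXn2l.
have main : `|x| ^+ j <= M * `|x| ^+ j.+1.
  have -> : `|x| ^+ j = `|pev x (mpolyX C (mnm_muln (mnm1 i) j))|.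
    by rewrite Xi normrX xi.
  rewrite -[mpolyX C _](subrK (\sum_y c i y *: (mpolyX C (bmnm y.1) * pminor T y.2))).
  rewrite [X in `|X|]mevalD; apply: le_trans (ler_normD _ _) _.
  apply: le_trans (lerD ((BP i).2 x x1) sumle) _.
  rewrite -mulrDl; apply: ler_wpM2r; first by rewrite exprn_ge0.
  by rewrite /M (bigD1 i) //= lerDl sumr_ge0.
have : 1 <= M * `|x|.
  by rewrite -(ler_pM2r (exprn_gt0 j x0)) mul1r -mulrA -exprS.
apply/negP; rewrite -real_ltNge ?ger0_real ?mulr_ge0 //.
apply: (@le_lt_trans _ _ (M * (1 / (M + 1 + 1)))); first exact: ler_wpM2l.
have M2 : 0 < M + 1 + 1 by rewrite addr_gt0.
by rewrite mulrA mulr1 ltr_pdivrMr // mul1r -addrA ltrDl addr_gt0.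
Qed.

End FiniteColength.

(** * Transversality and extension of jets *)

Section TangentVectors.
Variables (C : numFieldType) (m n : nat).
Implicit Types B : 'M[C]_(m, n).

Lemma near_unitmx p (P : 'M[C]_p) : \forall s \near (0 : C), 1%:M + s *: P \in unitmx.
Proof.
pose q : {poly C} := \det (1%:M + 'X *: map_mx polyC P).
have qE s : q.[s] = \det (1%:M + s *: P).
  rewrite /q -[LHS]/(horner_eval s _) -det_map_mx; congr (\det _).
  apply/matrixP => i j; rewrite !mxE /= /horner_eval.
  by rewrite !hornerE -raddfMn hornerC.
have q0 : q.[0] != 0 by rewrite qE scale0r addr0 det1 oner_eq0.
have : \forall s \near (0 : C), q.[s] != 0.
  have /factor_theorem[u uE] : root (q - q.[0]%:P) 0 by rewrite rootE !hornerE subrr.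
  pose K := \sum_(k < size u) `|u`_k|.
  have K1 : 0 < K + 1 by rewrite ltr_wpDl ?sumr_ge0.
  have nq0 : 0 < `|q.[0]| by rewrite normr_gt0.
  have [e [e0 e1 eK]] := exists_lower_bound (ltr01 : 0 < 1 :> C) (divr_gt0 nq0 K1).
  apply/nbhs_norm0P; exists e => //= s /ltW se.
  have us : `|u.[s]| <= K.
    rewrite horner_coef; apply: le_trans (ler_norm_sum _ _ _) _; apply: ler_sum => k _.
    by rewrite normrM normrX ler_piMr // exprn_ile1 // (le_trans se).
  apply: contraTneq nq0 => qs.
  have := congr1 (fun p => p.[s]) uE; rewrite !hornerE qs sub0r subr0 => q0E.
  have q0le : `|q.[0]| <= K * (`|q.[0]| / (K + 1)).
    rewrite -normrN q0E normrM; apply: ler_pM => //.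
    by rewrite -normrM -q0E normrN; exact: le_trans eK.
  apply/negP => nq0; move: q0le; rewrite mulrCA -{1}[`|_|]mulr1 ler_pM2l //.
  by rewrite ler_pdivlMr // mul1r gerDl ler10.
by apply: filterS => s; rewrite qE unitmxE unitfE.
Qed.

(** The curve s |-> (1 + s P) B (1 + s Q) has this velocity at 0, and its rank is
    constant as long as both outer factors are invertible. *)
Lemma orbit_tangent i B (P : 'M[C]_m) (Q : 'M[C]_n) : stratum i B ->
  tangent_space (stratum i) B (P *m B + B *m Q).
Proof.
move=> iB; pose V := P *m B + B *m Q; pose W := P *m B *m Q.
pose g (s : C) := (1%:M + s *: P) *m B *m (1%:M + s *: Q).
have gE s : g s = B + s *: V + s ^+ 2 *: W.
  rewrite /g /V /W mulmxDl mul1mx mulmxDr mulmx1 mulmxDl -!scalemxAl -!scalemxAr.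
  by rewrite scalerDr scalerA expr2 -!addrA; congr (_ + _); rewrite addrA [X in X + _]addrC -!addrA.
have dg s : (fun h : C => h^-1 *: ((g \o shift s) (h *: 1) - g s)) @ 0^' --> V + (s *+ 2) *: W.
  have cl : (fun h : C => V + (s *+ 2 + h) *: W) @ 0^' --> V + (s *+ 2 + 0) *: W.
    apply: cvgD; first exact: cvg_cst.
    apply: cvgZr_tmp; apply: cvgD; first exact: cvg_cst.
    exact: nbhs_dnbhs.
  rewrite addr0 in cl; apply: cvg_trans cl; apply: near_eq_cvg; near=> h.
  have h0 : h != 0 by near: h; exact: nbhs_dnbhs_neq.
  rewrite /= !gE [h *: 1]mulr1.
  have -> : B + (h + s) *: V + (h + s) ^+ 2 *: W - (B + s *: V + s ^+ 2 *: W) =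
      h *: (V + (s *+ 2 + h) *: W).
    by apply/matrixP => a b; rewrite !mxE; ring.
  by rewrite scalerA mulVf // scale1r.
exists g; split.
- by rewrite gE scale0r expr0n scale0r !addr0.
- have nP := near_unitmx P; have nQ := near_unitmx Q.
  apply: filterS2 nP nQ => s uP uQ; split.
    by apply/cvg_ex; exists (V + (s *+ 2) *: W); exact: dg.
  have rg : \rank (g s) = \rank B.
    rewrite /g mxrankMfree ?row_free_unit //.
    by rewrite -mxrank_tr trmx_mul mxrankMfree ?mxrank_tr // row_free_unit unitmx_tr.
  by move: iB; rewrite /stratum /rank_lt /= rg.
- rewrite /derive; apply: cvg_lim => //.
  by have := dg 0; rewrite mul0rn scale0r addr0.
Unshelve. all: by end_near. Qed.

End TangentVectors.

Section Transversality.
Variables (C : numFieldType) (N m n : nat).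

Lemma minors_transverse (F : 'rV[C]_N -> 'M[C]_(m, n)) x f i :
  analytic_at F x -> tminor (F x) (fun k => 'd F x (delta_mx 0 k)) f != 0 ->
  transverse_at F (stratum i) x.
Proof.
move=> Fx nz iF w; have [u [P [Q ->]]] := tminor_spans nz w.
exists (\row_k u k), (P *m F x + F x *m Q); split; first exact: orbit_tangent.
congr (_ + _); have [-> _] := analytic_differential Fx.
by apply: eq_bigr => k _; rewrite mxE.
Qed.

End Transversality.

Section Extension.
Variables (K : numClosedFieldType) (unc : uncountable K) (N m n : nat).

(** The coefficients of degree <= l of f + G, where f is the polynomial of the
    jet and G is homogeneous of degree r + 1 and good.  The order l depends
    only on r: the reduction to degree < s modulo the minors of f + G does not
    see f. *)
Lemma extend_to_finite_colength r : exists l (rl : (r <= l)%N),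
  forall z : jet K N m n r, exists z' : jet K N m n l, jet_trunc rl z' = z /\
  exists phi : jet K N m n l -> K, [/\ polyfun phi, phi z' != 0 & forall z, phi z != 0 ->
    exists2 j, (j < l)%N & forall b, mdeg b = j ->
    exists c : bmultinom N l * {ffun 'I_(m * n) -> tindex N m n} -> K,
    forall b', (mdeg b' <= j)%N ->
      mcoeff b' (mpolyX K b - \sum_x c x *: (mpolyX K (bmnm x.1) * pminor (jet_poly z) x.2)) = 0].
Proof.
have [G [s [homG Gs]]] := exists_homogeneous_finite unc N m n (ltn0Sn r).
pose l := (#|{: bmultinom N s}| + r.+1)%N.
have rl : (r <= l)%N by rewrite /l addnS leqW // leq_addl.
exists l, rl => z; pose M : 'M[mpoly N K]_(m, n) := jet_poly z + G.
have Mlead i j : leading r.+1 (M i j) (G i j).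
  split; first exact: homG.
  rewrite !mxE addrK; apply: msize_sum_le => a _.
  by apply: leq_trans (msizeZ_le _ _) _; rewrite mmeasureX bmdeg.
(* Here r < l, so that the jet of order l determines M. *)
pose z' : jet K N m n l := [ffun k => mcoeff (bmnm k.1.1) (M k.1.2 k.2)].
have z'M : jet_poly z' = M.
  apply/matrixP => i j; rewrite mxE [RHS](mpolywE (k := l.+1)).
    by apply: eq_bigr => a _; rewrite ffunE.
  have [hG MG] := Mlead i j; rewrite -[M i j](subrK (G i j)).
  apply: msize_add_le; first by apply: leq_trans MG _; rewrite /l; lia.
  by apply: leq_trans (homog_msize_le hG) _; rewrite /l; lia.
exists z'; split.
  apply/ffunP => -[[a i] j]; rewrite !ffunE /= mxE mcoeffD.
  rewrite (dhomog_nemf_coeff (homG i j)) ?addr0 /=; last by rewrite ltn_eqF // bmdeg.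
  rewrite mxE raddf_sum (bigD1 a) //= mcoeffZ mcoeffX eqxx mulr1 big1 ?addr0 // => b ba.
  by rewrite mcoeffZ mcoeffX -bmeqP (negPf ba) mulr0.
apply: (@exists_certificate _ _ _ _ _ s); last by rewrite /l; lia.
by move=> p; rewrite z'M; exact: minor_ideal_reduce Mlead Gs p.
Qed.

End Extension.

Local Open Scope complex_scope.

Theorem corollary3p5 (R : realType) (N m n t : nat)
    (hN : (1 <= N)%N) (hm : (1 <= m)%N) (hn : (1 <= n)%N)
    (ht : (1 <= t <= minn m n)%N) :
  exists A : set ('rV[R[i]]_N -> 'M[R[i]]_(m, n)),
    proalgebraic_infinite_codim A /\
    forall F : 'rV[R[i]]_N -> 'M[R[i]]_(m, n),
      analytic_germ F -> ~ A F -> determinantal_germ F t -> is_EIDS F t.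
Proof.
pose bad := [set F : 'rV[R[i]]_N -> 'M[R[i]]_(m, n) | analytic_germ F /\ ~ good_germ F].
exists [set F | analytic_germ F /\ forall r, bad_jets bad (jet_of r F)]; split.
  apply: bad_germs_infinite_codim => r.
  have [l [rl ext]] := extend_to_finite_colength (@uncountable_complex R) N m n r.
  exists l, rl => z; have [z' [z'z [phi [pphi nz phiP]]]] := ext z.
  exists z'; split=> // z'bad; case/eqP: nz; apply: z'bad; split=> // _ [F [anF nF] <-].
  apply/eqP; apply: contrapT => /negP /phiP[j jl comb].
  by apply: nF; exact: finite_colength_good anF jl comb.
move=> F anF nA detF; split=> //.
have good : good_germ F.
  apply: contrapT => nF; apply: nA; split=> // r.
  by apply: sub_zclosure; exists F.
near=> x => i _.
have [f nz] : exists f, tminor (F x) (fun k => 'd F x (delta_mx 0 k)) f != 0.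
  by near: x; exact: good.
apply: minors_transverse nz; near: x; exact: nbhs_dnbhs.
Unshelve. all: by end_near. Qed.
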